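(* Let $\mathcal{Q},\mathfrak{q}\in\mathbb{R}[[x_1,x_2,x_3,x_4]]$ be the generating series $$\mathcal{Q}(x_1,x_2,x_3,x_4)=\sum_{l_1\ge2,\;l_2,l_3,l_4\ge1}\zeta(l_1,l_2,l_3,l_4)\,x_1^{l_1-1}x_2^{l_2-1}x_3^{l_3-1}x_4^{l_4-1},$$ $$\mathfrak{q}(x_1,x_2,x_3,x_4)=\sum_{\substack{l_1,l_2,l_3,l_4\ge1\\ l_1+l_2+l_3+l_4>4}}\zeta(l_1+l_2+l_3+l_4)\,x_1^{l_1-1}x_2^{l_2-1}x_3^{l_3-1}x_4^{l_4-1}.$$ Then $$\mathcal{Q}\,|\,\Omega=\mathfrak{q},$$ where $\Omega\in\mathbb{Z}[GL_4(\mathbb{Z})]$ is $$\Omega = p\,\Sigma_{\mathfrak{S}_4}-\bigl(\Psi\Phi q-\Phi r-\Psi s+I\bigr)\Sigma_{\mathfrak{C}_4}.$$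
   Context: Multiple zeta values: for positive integers $l_1\ge 2$, $l_2,\dots,l_r\ge1$, $\zeta(l_1,\dots,l_r)=\sum_{m_1>m_2>\cdots>m_r>0}\frac{1}{m_1^{l_1}\cdots m_r^{l_r}}$; $\zeta(l)$ is the case $r=1$. Action: for $M\in GL_4(\mathbb{Z})$ and $f\in\mathbb{R}[[x_1,\dots,x_4]]$, $(f|M)(x_1,\dots,x_4)=f\bigl((x_1,\dots,x_4)M^t\bigr)$ with $M^t$ the transpose. This is a right action, extended linearly to the integral group ring $\mathbb{Z}[GL_4(\mathbb{Z})]$: $f|(\sum_j a_jM_j)=\sum_j a_j(f|M_j)$. Sums and products below are taken in this group ring (sums are formal, not matrix sums). Permutations: $\sigma\in\mathfrak{S}_4$ (the symmetric group) is identified with the matrix $(\delta_{i\sigma(j)})_{1\le i,j\le4}$. For a subset $H\subset\mathfrak{S}_4$, $\Sigma_H=\sum_{\sigma\in H}\sigma\in\mathbb{Z}[GL_4(\mathbb{Z})]$. $\mathfrak{C}_4=\langle(1234)\rangle=\{e,(1234),(13)(24),(1432)\}$. $I$ is the $4\times4$ identity matrix. Matrices: $$p=\begin{pmatrix}1&1&1&1\\0&1&1&1\\0&0&1&1\\0&0&0&1\end{pmatrix},\quad q=\begin{pmatrix}1&0&1&1\\0&1&1&1\\0&0&1&1\\0&0&0&1\end{pmatrix},\quad r=\begin{pmatrix}1&0&1&0\\0&1&1&0\\0&0&1&0\\0&0&0&1\end{pmatrix},\quad s=\begin{pmatrix}1&0&0&1\\0&1&0&1\\0&0&1&1\\0&0&0&1\end{pmatrix}.$$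 Group ring elements (formal sums of matrices): $$\Phi=I+\begin{pmatrix}1&0&0&0\\0&1&0&0\\0&1&-1&1\\0&0&0&1\end{pmatrix}+\begin{pmatrix}1&0&0&0\\1&0&-1&1\\0&1&-1&1\\0&0&0&1\end{pmatrix},$$ $$\Psi=I+\begin{pmatrix}1&0&0&0\\0&1&0&0\\0&0&1&0\\0&0&1&-1\end{pmatrix}+\begin{pmatrix}1&0&0&0\\0&1&0&0\\0&1&0&-1\\0&0&1&-1\end{pmatrix}+\begin{pmatrix}1&0&0&0\\1&0&0&-1\\0&1&0&-1\\0&0&1&-1\end{pmatrix}.$$ *)

(* Defs.v *)
From HB Require Import structures.
From mathcomp Require Import all_boot all_order all_algebra all_fingroup.
From mathcomp Require Import freeg mpoly.
From mathcomp Require Import classical_sets reals ereal esum.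

Set Implicit Arguments.
Unset Strict Implicit.
Unset Printing Implicit Defensive.

Import GRing.Theory Num.Theory.
Local Open Scope ring_scope.

(** * Multiple zeta values *)

(* The sum runs over m_1 > m_2 > ... > m_r > 0. It is the unordered sum of
   nonnegative terms, taken in \bar R; it is finite as soon as l_1 >= 2. *)
Definition mzv (R : realType) (r : nat) (l : r.-tuple nat) : R :=
  fine (\esum_(m in [set m : r.-tuple nat | sorted gtn m && all (leq 1) m]%classic)
    (\prod_(i < r) (tnth m i)%:R ^- tnth l i)%:E).

(** * The group GL_n(Z) *)

Definition GL (n : nat) := {M : 'M[int]_n | M \in unitmx}.
HB.instance Definition _ n := Choice.on (GL n).

Section GLGroup.
Variable n : nat.
Implicit Types A B : GL n.

Lemma GL_one_subproof : (1%:M : 'M[int]_n) \in unitmx.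
Proof. exact: unitmx1. Qed.

Lemma GL_mul_subproof A B : val A *m val B \in unitmx.
Proof. by rewrite unitmx_mul (valP A) (valP B). Qed.

Lemma GL_inv_subproof A : invmx (val A) \in unitmx.
Proof. by rewrite unitmx_inv (valP A). Qed.

Definition GL_one : GL n := Sub 1%:M GL_one_subproof.
Definition GL_mul A B : GL n := Sub (val A *m val B) (GL_mul_subproof A B).
Definition GL_inv A : GL n := Sub (invmx (val A)) (GL_inv_subproof A).

Lemma GL_mulA : associative GL_mul.
Proof. by move=> A B C; apply: val_inj; rewrite /= mulmxA. Qed.

Lemma GL_mul1 : left_id GL_one GL_mul.
Proof. by move=> A; apply: val_inj; rewrite /= mul1mx. Qed.

Lemma GL_mulr1 : right_id GL_one GL_mul.
Proof. by move=> A; apply: val_inj; rewrite /= mulmx1. Qed.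

Lemma GL_mulV : left_inverse GL_one GL_inv GL_mul.
Proof. by move=> A; apply: val_inj; rewrite /= mulVmx ?(valP A). Qed.

Lemma GL_mulrV : right_inverse GL_one GL_inv GL_mul.
Proof. by move=> A; apply: val_inj; rewrite /= mulmxV ?(valP A). Qed.

HB.instance Definition _ :=
  isGroup.Build (GL n) GL_mulA GL_mul1 GL_mulr1 GL_mulV GL_mulrV.

End GLGroup.

(** * The integral group ring Z[G] *)

(* Finitely supported functions G -> int, with the convolution product. *)
Definition zgring (G : groupType) := {freeg G}.
HB.instance Definition _ (G : groupType) := GRing.Zmodule.on (zgring G).

Section GroupRing.
Variable G : groupType.
Implicit Types (g h : G) (a b c : zgring G).

Definition zg g : zgring G := << g >>.

Definition zgring_mul a b : zgring G :=
  \sum_(g <- dom a) \sum_(h <- dom b)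
    << coeff g a * coeff h b *g (g * h)%g >>.

Section Lift.
Variables (M : lmodType int) (f : G -> M).

Let lift0 : fglift f 0 = 0 :> M.
Proof. by rewrite -freeg_nil fglift_Freeg prelift_nil. Qed.

Let liftB a b : fglift f (a - b) = fglift f a - fglift f b :> M.
Proof. exact: lift_is_additive. Qed.

Let liftD a b : fglift f (a + b) = fglift f a + fglift f b :> M.
Proof. by rewrite -{1}[b]opprK -[- b]sub0r !liftB lift0 sub0r opprK. Qed.

Lemma zglift_sum I (s : seq I) (F : I -> zgring G) :
  fglift f (\sum_(i <- s) F i) = \sum_(i <- s) fglift f (F i).
Proof. exact: (big_morph (fglift f) liftD lift0). Qed.

Lemma zgliftD a b : fglift f (a + b) = fglift f a + fglift f b.
Proof. exact: liftD. Qed.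

Lemma zgliftE a : fglift f a = \sum_(g <- dom a) coeff g a *: f g.
Proof.
rewrite -[in LHS](freeg_sumE a) zglift_sum.
by apply: eq_bigr => g _; rewrite liftU.
Qed.
End Lift.

Let row b g : zgring G := fglift (fun h => zg (g * h)%g : {freeg G}) b.

Let mulE a b : zgring_mul a b = fglift (row b : G -> {freeg G}) a.
Proof.
rewrite zgliftE; apply: eq_bigr => g _; rewrite /row zgliftE scaler_sumr.
apply: eq_bigr => h _; apply/eqP/freeg_eqP => x.
by rewrite !coeffZ !coeffU mul1r mulrA.
Qed.

Let zgmulDl : left_distributive zgring_mul +%R.
Proof. by move=> a b c; rewrite !mulE zgliftD. Qed.

Let zgmulDr : right_distributive zgring_mul +%R.
Proof.
move=> a b c; rewrite !mulE !zgliftE -big_split /=.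
by apply: eq_bigr => g _; rewrite /row zgliftD scalerDr.
Qed.

Let zgmulUU k l g h :
  zgring_mul << k *g g >> << l *g h >> = << k * l *g (g * h)%g >>.
Proof.
rewrite mulE liftU /row liftU; apply/eqP/freeg_eqP => x.
by rewrite !coeffZ !coeffU mul1r mulrA.
Qed.

Let mul0z a : zgring_mul 0 a = 0.
Proof. by rewrite /zgring_mul dom0 big_nil. Qed.

Let mulz0 a : zgring_mul a 0 = 0.
Proof. by rewrite /zgring_mul dom0 big1 // => g _; rewrite big_nil. Qed.

Let zg_ind (P : zgring G -> Prop) : P 0 ->
  (forall a b, P a -> P b -> P (a + b)) -> (forall k g, P << k *g g >>) ->
  forall a, P a.
Proof.
by move=> P0 PD PU a; rewrite -(freeg_sumE a); apply: (big_ind P).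
Qed.

Fact zgring_mulA : associative zgring_mul.
Proof.
elim/zg_ind => [b c|a a' IHa IHa' b c|k g]; first by rewrite !mul0z.
  by rewrite !zgmulDl IHa IHa'.
elim/zg_ind => [c|b b' IHb IHb' c|l h]; first by rewrite !(mulz0, mul0z).
  by rewrite !(zgmulDl, zgmulDr) IHb IHb'.
elim/zg_ind => [|c c' IHc IHc'|m x]; first by rewrite !mulz0.
  by rewrite !zgmulDr IHc IHc'.
by rewrite !zgmulUU mulrA mulgA.
Qed.

Fact zgring_mul1 : left_id (zg 1%g) zgring_mul.
Proof.
elim/zg_ind => [|a b IHa IHb|k g]; first exact: mulz0.
  by rewrite zgmulDr IHa IHb.
by rewrite zgmulUU mul1r mul1g.
Qed.

Fact zgring_mulr1 : right_id (zg 1%g) zgring_mul.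
Proof.
elim/zg_ind => [|a b IHa IHb|k g]; first exact: mul0z.
  by rewrite zgmulDl IHa IHb.
by rewrite zgmulUU mulr1 mulg1.
Qed.

Fact zgring_mulDl : left_distributive zgring_mul +%R.
Proof. exact: zgmulDl. Qed.

Fact zgring_mulDr : right_distributive zgring_mul +%R.
Proof. exact: zgmulDr. Qed.

Fact zgring_1_neq0 : zg 1%g != 0.
Proof.
by apply/eqP => /(congr1 (coeff (1%g : G))); rewrite coeffU coeff0 eqxx.
Qed.

HB.instance Definition _ := GRing.Zmodule_isNzRing.Build (zgring G)
  zgring_mulA zgring_mul1 zgring_mulr1 zgring_mulDl zgring_mulDr zgring_1_neq0.

Lemma zgM g h : zg (g * h)%g = zg g * zg h.
Proof. by rewrite [RHS]zgmulUU mulr1. Qed.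

End GroupRing.

(** * Formal power series and the right action of Z[GL_n(Z)] *)

(* A series in R[[x_1, ..., x_n]] is given by its coefficients. *)
Definition fps (n : nat) (R : Type) := 'X_{1..n} -> R.

Section Action.
Variables (n : nat) (R : comNzRingType).
Implicit Types (f : fps n R) (M : GL n) (a : zgring (GL n)).

Definition fps_trunc (d : nat) f : {mpoly R[n]} :=
  \sum_(m : 'X_{1..n < d.+1}) f m *: 'X_[m].

(* The i-th entry of the row vector (x_1, ..., x_n) M^t. *)
Definition GL_form M (i : 'I_n) : {mpoly R[n]} :=
  \sum_(j < n) ((val M i j)%:~R : R) *: 'X_j.

(* f((x_1, ..., x_n) M^t). Substituting linear forms preserves the degree, so
   the coefficient at m only depends on the terms of f of degree <= mdeg m. *)
Definition fps_act f M : fps n R := fun m =>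
  (fps_trunc (mdeg m) f \mPo [tuple GL_form M i | i < n])@_m.

Definition fps_zact f a : fps n R := fun m =>
  \sum_(M <- dom a) (coeff M a)%:~R * fps_act f M m.

End Action.

(** * The elements of GL_4(Z) and Z[GL_4(Z)] *)

Definition mx4 (A : seq (seq int)) : 'M[int]_4 :=
  \matrix_(i, j) nth 0 (nth [::] A i) j.

Definition mul4 (A B : seq (seq int)) : seq (seq int) :=
  let a i k := nth 0 (nth [::] A i) k in
  let b k j := nth 0 (nth [::] B k) j in
  [seq [seq a i 0%N * b 0%N j
            + (a i 1%N * b 1%N j + (a i 2%N * b 2%N j + a i 3%N * b 3%N j))
       | j <- iota 0 4] | i <- iota 0 4].

Lemma mx4_unit (A B : seq (seq int)) :
  mul4 A B == [:: [:: 1; 0; 0; 0]; [:: 0; 1; 0; 0];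
                  [:: 0; 0; 1; 0]; [:: 0; 0; 0; 1]] ->
  mx4 A \in unitmx.
Proof.
move=> /eqP AB; suff /mulmx1_unit[]: mx4 A *m mx4 B = 1%:M by [].
apply/matrixP => i j.
have := congr1 (fun s => nth 0 (nth [::] s i) j) AB.
rewrite !mxE !big_ord_recl big_ord0 !mxE /= addr0.
by case: i => -[|[|[|[|//]]]] ? /=; case: j => -[|[|[|[|//]]]] ? /= ->.
Qed.

(* The matrix with rows A; its inverse B only certifies invertibility. *)
Definition gl4 (A B : seq (seq int)) AB : GL 4 := Sub (mx4 A) (@mx4_unit A B AB).

Definition GLp : GL 4 := @gl4
  [:: [:: 1; 1; 1; 1]; [:: 0; 1; 1; 1]; [:: 0; 0; 1; 1]; [:: 0; 0; 0; 1]]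
  [:: [:: 1; -1; 0; 0]; [:: 0; 1; -1; 0]; [:: 0; 0; 1; -1]; [:: 0; 0; 0; 1]]
  isT.

Definition GLq : GL 4 := @gl4
  [:: [:: 1; 0; 1; 1]; [:: 0; 1; 1; 1]; [:: 0; 0; 1; 1]; [:: 0; 0; 0; 1]]
  [:: [:: 1; 0; -1; 0]; [:: 0; 1; -1; 0]; [:: 0; 0; 1; -1]; [:: 0; 0; 0; 1]]
  isT.

Definition GLr : GL 4 := @gl4
  [:: [:: 1; 0; 1; 0]; [:: 0; 1; 1; 0]; [:: 0; 0; 1; 0]; [:: 0; 0; 0; 1]]
  [:: [:: 1; 0; -1; 0]; [:: 0; 1; -1; 0]; [:: 0; 0; 1; 0]; [:: 0; 0; 0; 1]]
  isT.

Definition GLs : GL 4 := @gl4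
  [:: [:: 1; 0; 0; 1]; [:: 0; 1; 0; 1]; [:: 0; 0; 1; 1]; [:: 0; 0; 0; 1]]
  [:: [:: 1; 0; 0; -1]; [:: 0; 1; 0; -1]; [:: 0; 0; 1; -1]; [:: 0; 0; 0; 1]]
  isT.

Definition GLPhi1 : GL 4 := @gl4
  [:: [:: 1; 0; 0; 0]; [:: 0; 1; 0; 0]; [:: 0; 1; -1; 1]; [:: 0; 0; 0; 1]]
  [:: [:: 1; 0; 0; 0]; [:: 0; 1; 0; 0]; [:: 0; 1; -1; 1]; [:: 0; 0; 0; 1]]
  isT.

Definition GLPhi2 : GL 4 := @gl4
  [:: [:: 1; 0; 0; 0]; [:: 1; 0; -1; 1]; [:: 0; 1; -1; 1]; [:: 0; 0; 0; 1]]
  [:: [:: 1; 0; 0; 0]; [:: 1; -1; 1; 0]; [:: 1; -1; 0; 1]; [:: 0; 0; 0; 1]]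
  isT.

Definition GLPsi1 : GL 4 := @gl4
  [:: [:: 1; 0; 0; 0]; [:: 0; 1; 0; 0]; [:: 0; 0; 1; 0]; [:: 0; 0; 1; -1]]
  [:: [:: 1; 0; 0; 0]; [:: 0; 1; 0; 0]; [:: 0; 0; 1; 0]; [:: 0; 0; 1; -1]]
  isT.

Definition GLPsi2 : GL 4 := @gl4
  [:: [:: 1; 0; 0; 0]; [:: 0; 1; 0; 0]; [:: 0; 1; 0; -1]; [:: 0; 0; 1; -1]]
  [:: [:: 1; 0; 0; 0]; [:: 0; 1; 0; 0]; [:: 0; 1; -1; 1]; [:: 0; 1; -1; 0]]
  isT.

Definition GLPsi3 : GL 4 := @gl4
  [:: [:: 1; 0; 0; 0]; [:: 1; 0; 0; -1]; [:: 0; 1; 0; -1]; [:: 0; 0; 1; -1]]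
  [:: [:: 1; 0; 0; 0]; [:: 1; -1; 1; 0]; [:: 1; -1; 0; 1]; [:: 1; -1; 0; 0]]
  isT.

Definition Phi : zgring (GL 4) := 1 + zg GLPhi1 + zg GLPhi2.

Definition Psi : zgring (GL 4) := 1 + zg GLPsi1 + zg GLPsi2 + zg GLPsi3.

Lemma GL_perm_subproof n (s : 'S_n) :
  (\matrix_(i, j) (i == s j)%:R : 'M[int]_n) \in unitmx.
Proof.
rewrite (_ : \matrix_(i, j) _ = perm_mx s^-1%g) ?unitmx_perm //.
by apply/matrixP => i j; rewrite !mxE (canF_eq (permKV s)).
Qed.

(* This is the transpose of MathComp's perm_mx s. *)
Definition GL_perm n (s : 'S_n) : GL n :=
  Sub (\matrix_(i, j) (i == s j)%:R) (GL_perm_subproof s).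

Definition Sigma n (H : {set 'S_n}) : zgring (GL n) :=
  \sum_(s in H) zg (GL_perm s).

(* The cycle (1234), which sends i to i + 1 modulo 4. *)
Definition cycle4 : 'S_4 := perm (@ordS_inj 4).

Definition C4 : {set 'S_4} := <[cycle4]>%g.

Definition Omega : zgring (GL 4) :=
  zg GLp * Sigma [set: 'S_4]
  - (Psi * Phi * zg GLq - Phi * zg GLr - Psi * zg GLs + 1) * Sigma C4.

(** * The generating series *)

(* The monomial m carries the zeta values of exponents l_i = m_i + 1. *)
Definition Qseries (R : realType) : fps 4 R := fun m =>
  let l := [tuple (m i).+1 | i < 4] in
  if (2 <= tnth l ord0)%N then mzv R l else 0.

Definition qseries (R : realType) : fps 4 R := fun m =>
  let w := (\sum_(i < 4) (m i).+1)%N in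
  if (4 < w)%N then mzv R [tuple w] else 0.

(* Main.v *)
From HB Require Import structures.
Require Import Defs.
From mathcomp Require Import all_boot all_order all_algebra all_fingroup.
From mathcomp Require Import freeg mpoly.
From mathcomp Require Import boolp classical_sets cardinality fsbigop.
From mathcomp Require Import reals ereal esum.
From mathcomp Require Import zify ring lra.

Set Implicit Arguments.
Unset Strict Implicit.
Unset Printing Implicit Defensive.

Import Order.TTheory GRing.Theory Num.Theory.
Local Open Scope ring_scope.

(** For one variable t write
      L_r(x_1, ..., x_r) = sum over m_1 > ... > m_r > 0 of
                           t ^ m_1 / ((m_1 - x_1) ... (m_r - x_r)),
    the generating series of the multiple polylogarithms of depth r. The
    partial fraction 1 / (u v) = (1 / u + 1 / v) / (u + v) gives their shuffle
    product, an identity of formal power series in t (lemma [shuffle]). It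
    identifies the pieces of Omega:
    - L_4 | p Sigma(S_4) is the product of the four L_1(x_i);
    - L_4 | Psi Phi q is L_2(x_1, x_2) L_1(x_3) L_1(x_4);
    - L_4 | Psi s is L_3(x_1, x_2, x_3) L_1(x_4);
    - L_4 | Phi r (e + (13)(24)) is L_2(x_1, x_2) L_2(x_3, x_4).
    So L_4 | Omega is an alternating sum of products of L's over the proper
    subsets of the edges of the 4-cycle, one product for each way of imposing
    m_i > m_(i+1) along some of the edges. As a sum over all (m_1, ..., m_4) it
    is inclusion-exclusion, with the summand
      prod_i (t ^ m_(i+1) - [m_i > m_(i+1)]) / (m_i - x_i),   i modulo 4;
    the set of all four edges contributes nothing because m_1 > ... > m_4 > m_1
    is impossible. When t tends to 1 the numerator tends to 1 on the diagonal
    m_1 = m_2 = m_3 = m_4 and to 0 elsewhere, and the diagonal alone is the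
    generating series of the single zeta values.

    The terms with l_1 = 1 are missing from Q, and their limits do not exist.
    They form the series in which the outer factor 1 / (m_1 - x_1) is replaced by
    1 / m_1, and Omega annihilates that series for each t: the shuffle identities
    hold with the outermost operator left unspecified, and if this operator does
    not depend on its argument then everything cancels ([zact_Omega],
    [zact_Omega_J0]).

    The limit is taken on finite sums: for a fixed monomial, both sides are
    truncated at t ^ K, with t = 1 - 2 ^ (- j) and K = 4 ^ j. Off the diagonal,
    the cycle descends to its least entry, which gives a factor
    1 - t ^ min <= (1 - t) min. As the monomial is not constant, some m_i occurs
    with an exponent at least 2 and absorbs min, so the error is at most
    4 (1 - t) H_K ^ 4, where H_K is the harmonic sum, plus 16 K ^ 4 t ^ K for the
    truncation ([diagonal_approx]). The quantity (1 - t) H_K ^ 4 also bounds the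
    difference between the truncated coefficients of Q at t and at 1
    ([Qcoef_approx]), and both quantities tend to 0. *)

(** * Formal power series in one variable *)

(** A record and not an alias of nat -> B: functions into a ring already carry
    the pointwise product. *)
Record ps (B : Type) := Ps { pscoef : nat -> B }.
Coercion pscoef : ps >-> Funclass.

HB.instance Definition _ B := gen_eqMixin (ps B).
HB.instance Definition _ B := gen_choiceMixin (ps B).

Lemma psP (B : Type) (f g : ps B) : f =1 g -> f = g.
Proof. by case: f g => [f] [g] /= /funext ->. Qed.

Section PsZmodule.
Variable B : zmodType.
Implicit Types f g : ps B.

Definition ps_zero : ps B := Ps (fun=> 0).
Definition ps_opp f : ps B := Ps (fun n => - f n).
Definition ps_add f g : ps B := Ps (fun n => f n + g n).

Fact ps_addA : associative ps_add.
Proof. by move=> f g h; apply: psP => n /=; rewrite addrA. Qed.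
Fact ps_addC : commutative ps_add.
Proof. by move=> f g; apply: psP => n /=; rewrite addrC. Qed.
Fact ps_add0 : left_id ps_zero ps_add.
Proof. by move=> f; apply: psP => n /=; rewrite add0r. Qed.
Fact ps_addN : left_inverse ps_zero ps_opp ps_add.
Proof. by move=> f; apply: psP => n /=; rewrite addNr. Qed.

HB.instance Definition _ :=
  GRing.isZmodule.Build (ps B) ps_addA ps_addC ps_add0 ps_addN.

(** The coefficient as a named function, to carry its additivity. *)
Definition psco n f : B := f n.

Lemma psco_zmod n : zmod_morphism (psco n). Proof. by []. Qed.
HB.instance Definition _ n :=
  GRing.isZmodMorphism.Build (ps B) B (psco n) (psco_zmod n).

Lemma psDE f g n : (f + g) n = f n + g n. Proof. by []. Qed.

Lemma ps_sumE n I (r : seq I) (P : pred I) (F : I -> ps B) :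
  (\sum_(i <- r | P i) F i) n = \sum_(i <- r | P i) F i n.
Proof. exact: (raddf_sum (psco n)). Qed.

End PsZmodule.

Section PsRing.
Variable B : comNzRingType.
Implicit Types f g h : ps B.

Definition ps_one : ps B := Ps (fun n => (n == 0)%:R).
Definition ps_mul f g : ps B := Ps (fun n => \sum_(i < n.+1) f i * g (n - i)%N).

(* The coefficient of index n of a product involves only the first n + 1
   coefficients, so the ring laws are those of polynomials. *)
Let trunc n f : {poly B} := \poly_(i < n.+1) f i.

Let trunc_mul n f g i : (i <= n)%N ->
  ps_mul f g i = (trunc n f * trunc n g)`_i.
Proof.
move=> lein; rewrite coefM; apply: eq_bigr => -[j /= ltji] _.
by rewrite !coef_poly !ifT //; lia.
Qed.

Fact ps_mulC : commutative ps_mul.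
Proof. by move=> f g; apply: psP => n; rewrite !(trunc_mul _ _ (leqnn n)) mulrC. Qed.

Fact ps_mulA : associative ps_mul.
Proof.
move=> f g h; apply: psP => n; transitivity ((trunc n f * trunc n g * trunc n h)`_n).
  rewrite -mulrA coefM; apply: eq_bigr => -[j ltjn] _.
  by rewrite coef_poly ltjn (@trunc_mul n) // leq_subr.
rewrite coefM; apply: eq_bigr => -[j ltjn] _.
by rewrite coef_poly (@trunc_mul n) // ifT //=; lia.
Qed.

Fact ps_mul1 : left_id ps_one ps_mul.
Proof.
move=> f; apply: psP => n /=.
by rewrite big_ord_recl /= mul1r subn0 big1 ?addr0 // => i _; rewrite mul0r.
Qed.

Fact ps_mulDl : left_distributive ps_mul +%R.
Proof.
move=> f g h; apply: psP => n /=; rewrite -big_split.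
by apply: eq_bigr => i _; rewrite /= mulrDl.
Qed.

Fact ps_1_neq0 : ps_one != 0.
Proof. by apply/eqP => /(congr1 (fun f : ps B => f 0%N)) /eqP; rewrite /= oner_eq0. Qed.

HB.instance Definition _ := GRing.Zmodule_isComNzRing.Build (ps B)
  ps_mulA ps_mulC ps_mul1 ps_mulDl ps_1_neq0.

Lemma psME f g n : (f * g) n = \sum_(i < n.+1) f i * g (n - i)%N.
Proof. by []. Qed.

End PsRing.

(** * The shuffle product *)

Section Shuffle.
Variables (A : zmodType) (B : comNzRingType) (z : {additive A -> B}).
(* The elements z a play the role of infinitesimal arguments, and e N a is
   1 / (N - z a). *)
Variable e : nat -> A -> B.
Hypothesis eP : forall N a, (0 < N)%N -> (N%:R - z a) * e N a = 1.
Implicit Types (a b : A) (f g h : ps B).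

(** The series t / (1 - t). *)
Definition tsum : ps B := Ps (fun N => (0 < N)%:R).
(** The iterated sums: J a1 (J a2 (... 1)) is the series
    L_r(a1, a2, ...), because its coefficient of index N, the largest index, is
    1 / (N - a1) times the sum over smaller indices. Equivalently J a f is the
    solution h, without constant term, of (t d/dt - a) h = t / (1 - t) f. *)
Definition J a f : ps B := Ps (fun N => e N a * (tsum * f) N).

Lemma JE a f N : J a f N = e N a * (tsum * f) N. Proof. by []. Qed.

Lemma tsumE f N : (tsum * f) N = \sum_(i < N) f i.
Proof.
rewrite psME (reindex_inj rev_ord_inj) /= big_ord_recr /= subnn mul0r addr0.
apply: eq_bigr => i _; rewrite subSS subn_gt0 ltn_ord mul1r.
by congr (f _); have := ltn_ord i; lia.
Qed.

Lemma J0 a f : J a f 0%N = 0.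
Proof. by rewrite JE tsumE big_ord0 mulr0. Qed.

Lemma JP a f N : (N%:R - z a) * J a f N = (tsum * f) N.
Proof.
case: N => [|N]; first by rewrite J0 mulr0 tsumE big_ord0.
by rewrite JE mulrA eP // mul1r.
Qed.

Lemma J_eq a f h : h 0%N = 0 ->
  (forall N, (N%:R - z a) * h N = (tsum * f) N) -> h = J a f.
Proof.
move=> h0 hE; apply: psP => -[|N]; first by rewrite J0.
by rewrite JE -hE mulrA [e _ _ * _]mulrC eP // mul1r.
Qed.

Lemma JD a f g : J a (f + g) = J a f + J a g.
Proof. by apply: psP => N; rewrite JE [tsum * _]mulrDr psDE mulrDr. Qed.

(** The operator t d/dt is a derivation, so (t d/dt - a - b) applied to
    the product of J a f and J b g is a sum of two terms, in which one of the
    factors is differentiated. *)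
Lemma shuffle a b f g : J a f * J b g = J (a + b) (f * J b g + J a f * g).
Proof.
apply: J_eq => [|N]; first by rewrite psME big_ord_recl big_ord0 !J0 mul0r addr0.
transitivity ((tsum * f * J b g + J a f * (tsum * g)) N); last first.
  apply: (congr1 (fun h : ps B => h N)).
  by rewrite mulrDr !mulrA [tsum * J a f]mulrC.
rewrite !psME; transitivity (\sum_(i < N.+1)
    ((tsum * f) i * J b g (N - i)%N + J a f i * (tsum * g) (N - i)%N));
  last by rewrite big_split.
rewrite mulr_sumr; apply: eq_bigr => -[i leiN] _.
rewrite -(JP a) -(JP b) raddfD (_ : N%:R = i%:R + (N - i)%:R :> B) /=; first by ring.
by rewrite -natrD; congr _%:R; lia.
Qed.

End Shuffle.

(** * The action of the group ring on functions of vectors *)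

Section FunctionAction.
Variables (n : nat) (A : zmodType).
Implicit Types (y : 'I_n -> A) (M : GL n).

Definition mact M y : 'I_n -> A := fun i => \sum_j y j *~ val M i j.

Lemma mact1 y : mact 1%g y = y.
Proof.
apply: funext => i; rewrite /mact (bigD1 i) //= mxE eqxx mulr1z big1 ?addr0 //.
by move=> j ji; rewrite mxE eq_sym (negPf ji) mulr0z.
Qed.

Lemma mactM M1 M2 y : mact (M1 * M2)%g y = mact M1 (mact M2 y).
Proof.
apply: funext => i; rewrite /mact.
under [RHS]eq_bigr do rewrite mulrz_suml.
rewrite exchange_big /=; apply: eq_bigr => j _; rewrite mxE mulrz_sumr.
by apply: eq_bigr => k _; rewrite -mulrzA mulrC.
Qed.

Lemma mact_perm (s : 'S_n) y : mact (GL_perm s) y = y \o s^-1%g.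
Proof.
apply: funext => i; rewrite /mact (bigD1 (s^-1 i)%g) //= mxE permKV eqxx mulr1z.
rewrite big1 ?addr0 // => j ji; rewrite mxE; case: eqP => // ij.
by rewrite ij permK eqxx in ji.
Qed.

Section Zact.
Variable V : zmodType.
Implicit Types (f : ('I_n -> A) -> V) (a b : zgring (GL n)).

(** The right action of the group ring, for functions of a vector instead of
    power series. Here it is compatible with products by definition, whereas
    substitution into power series would need a composition law. *)
Definition zact f a y : V := \sum_(M <- dom a) f (mact M y) *~ coeff M a.

Let zactE f a y : zact f a y = fglift (fun M => f (mact M y) : zmodule V) a.
Proof. by rewrite zgliftE. Qed.

Lemma zactD f a b y : zact f (a + b) y = zact f a y + zact f b y.
Proof. by rewrite !zactE zgliftD. Qed.

Lemma zactN f a y : zact f (- a) y = - zact f a y.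
Proof.
by apply/eqP; rewrite -addr_eq0 -zactD addNr /zact dom0 big_nil.
Qed.

Lemma zactU f k M y : zact f << k *g M >> y = f (mact M y) *~ k.
Proof. by rewrite zactE liftU. Qed.

Lemma zactG f M y : zact f (zg M) y = f (mact M y).
Proof. exact: zactU. Qed.

Lemma zact1 f y : zact f 1 y = f y.
Proof. by rewrite zactG mact1. Qed.

Lemma zact_sum f I (r : seq I) (F : I -> zgring (GL n)) y :
  zact f (\sum_(i <- r) F i) y = \sum_(i <- r) zact f (F i) y.
Proof. by rewrite zactE zglift_sum; apply: eq_bigr => i _; rewrite zactE. Qed.

Lemma zactM f a b y : zact f (a * b) y = zact (zact f a) b y.
Proof.
transitivity (zact f (zgring_mul a b) y) => //; rewrite zact_sum.
under eq_bigr do rewrite zact_sum.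
rewrite exchange_big; apply: eq_bigr => N _; rewrite [zact f a _]/zact mulrz_suml.
by apply: eq_bigr => M _; rewrite zactU mactM mulrzA.
Qed.

Lemma zact_Sigma f (H : {set 'S_n}) y :
  zact f (Sigma H) y = \sum_(s in H) f (y \o s^-1%g).
Proof.
rewrite /Sigma -big_enum zact_sum -[RHS]big_enum.
by apply: eq_bigr => s _; rewrite zactG mact_perm.
Qed.

End Zact.
End FunctionAction.

(** * Sums over permutations *)

Section PermSums.
Variable V : nmodType.

Lemma sum_perm_inv n (H : {group 'S_n}) (F : 'S_n -> V) :
  \sum_(s in H) F s^-1%g = \sum_(s in H) F s.
Proof.
by rewrite (reindex_inj invg_inj); apply: eq_big => s; rewrite ?groupV ?invgK.
Qed.

(** Replaces the abstract symmetric group by the lists of its values, which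
    can be split according to their first entry. *)
Lemma sum_permutations n (F : seq 'I_n -> V) :
  \sum_(s : 'S_n) F [seq s i | i <- enum 'I_n] =
    \sum_(l <- permutations (enum 'I_n)) F l.
Proof.
rewrite -big_enum -(big_map (fun s : 'S_n => [seq s i | i <- enum 'I_n]) xpredT).
apply: perm_big; apply: uniq_perm; rewrite ?permutations_uniq //.
  rewrite map_inj_uniq ?enum_uniq // => s t /eq_in_map st; apply/permP => i.
  by apply: st; rewrite mem_enum.
move=> l; rewrite mem_permutations; apply/mapP/idP => [[s _ ->]|lP].
  apply: uniq_perm; rewrite ?(map_inj_uniq (@perm_inj _ s)) ?enum_uniq //.
  move=> i; rewrite mem_enum; apply/mapP; exists (s^-1 i)%g; rewrite ?permKV //.
  exact: mem_enum.
have szl : size l = n by rewrite (perm_size lP) size_enum_ord.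
have ul : uniq l by rewrite (perm_uniq lP) enum_uniq.
case: n => [|n] in F l lP szl ul *.
  by exists 1%g; rewrite ?mem_enum // (size0nil szl) enum_ord0.
have inj : injective (fun i : 'I_n.+1 => nth ord0 l i).
  by move=> i j /eqP; rewrite nth_uniq ?szl // => /eqP/val_inj.
exists (perm inj); first by rewrite mem_enum.
apply: (@eq_from_nth _ ord0) => [|i]; first by rewrite size_map size_enum_ord.
rewrite szl => ltin; rewrite (nth_map ord0) ?size_enum_ord // permE.
by rewrite nth_enum_ord.
Qed.

Lemma sum_C4 (F : 'S_4 -> V) :
  \sum_(s in C4) F s =
    F 1%g + F cycle4 + F (cycle4 ^+ 2)%g + F (cycle4 ^+ 3)%g.
Proof.
have c4 : (cycle4 ^+ 4 = 1)%g.
  by apply/permP => i; rewrite perm1 permX /= !permE; apply: val_inj; case: i => -[|[|[|[]]]].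
have ord_ne (j k : nat) : (j < 4)%N -> (k < 4)%N -> j != k ->
    (cycle4 ^+ j != cycle4 ^+ k)%g.
  move=> j4 k4; apply: contra => /eqP/permP/(_ ord0); rewrite !permX.
  have it (m : nat) : (m < 4)%N -> val (iter m cycle4 ord0) = m.
    by case: m => [|[|[|[]]]] //= _; rewrite !permE.
  by move=> /(congr1 val); rewrite !it // => ->.
pose r : seq 'S_4 := [seq cycle4 ^+ i | i <- iota 0 4]%g.
have ur : uniq r.
  rewrite map_inj_in_uniq ?iota_uniq // => j k; rewrite !mem_iota => j4 k4 jk.
  by apply/eqP; apply: contraTT (ord_ne j k j4 k4) _ => //; rewrite jk eqxx.
transitivity (\sum_(s in r) F s); last first.
  by rewrite -big_uniq //= !big_cons big_nil addr0 !addrA expg0 expg1.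
apply: eq_bigl => s; apply/cycleP/mapP => [[i ->]|[i _ ->]]; last by exists i.
exists (i %% 4)%N; first by rewrite mem_iota /= ltn_mod.
by rewrite expg_mod.
Qed.

End PermSums.

(** * The shuffle relations in depth four *)

Definition i0 : 'I_4 := @Ordinal 4 0 isT.
Definition i1 : 'I_4 := @Ordinal 4 1 isT.
Definition i2 : 'I_4 := @Ordinal 4 2 isT.
Definition i3 : 'I_4 := @Ordinal 4 3 isT.

Lemma enum4 : enum 'I_4 = [:: i0; i1; i2; i3].
Proof. by apply: (inj_map val_inj); rewrite val_enum_ord. Qed.

Lemma sum4 (V : zmodType) (F : 'I_4 -> V) :
  \sum_i F i = F i0 + (F i1 + (F i2 + F i3)).
Proof. by rewrite -big_enum enum4 !big_cons big_nil /= addr0. Qed.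

Section Depth4.
Variables (A B : comNzRingType) (z : {additive A -> B}) (e : nat -> A -> B).
Hypothesis eP : forall N a, (0 < N)%N -> (N%:R - z a) * e N a = 1.
Implicit Types (a b c d : A) (f g h : ps B).
Local Notation J := (J e).

Definition vec4 a b c d : 'I_4 -> A := fun i => nth 0 [:: a; b; c; d] i.

Lemma vec4E (y : 'I_4 -> A) : y = vec4 (y i0) (y i1) (y i2) (y i3).
Proof.
by apply: funext => -[[|[|[|[|//]]]] i4]; congr (y _); apply: val_inj.
Qed.

Lemma vec4_cycle a b c d : vec4 a b c d \o cycle4 = vec4 b c d a.
Proof. by apply: funext => -[[|[|[|[|//]]]] i4] /=; rewrite permE. Qed.

(** The actions of the nine matrices are spelled out once and for all, so that
    the products in Omega become substitutions. *)
Lemma mact_gl4 (M M' : seq (seq int)) MM' a b c d :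
  let row i := let m j := (nth 0 (nth [::] M i) j)%:~R in
    a * m 0%N + b * m 1%N + c * m 2%N + d * m 3%N in
  mact (@gl4 M M' MM') (vec4 a b c d)
    = vec4 (row 0%N) (row 1%N) (row 2%N) (row 3%N).
Proof.
apply: funext => -[[|[|[|[|//]]]] i4];
  by rewrite /mact sum4 /= !mxE !mulrzr !addrA.
Qed.

Lemma mact_GLp a b c d :
  mact GLp (vec4 a b c d) = vec4 (a + b + c + d) (b + c + d) (c + d) (d).
Proof. by rewrite mact_gl4 /=; congr vec4; ring. Qed.

Lemma mact_GLq a b c d :
  mact GLq (vec4 a b c d) = vec4 (a + c + d) (b + c + d) (c + d) (d).
Proof. by rewrite mact_gl4 /=; congr vec4; ring. Qed.

Lemma mact_GLr a b c d :
  mact GLr (vec4 a b c d) = vec4 (a + c) (b + c) (c) (d).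
Proof. by rewrite mact_gl4 /=; congr vec4; ring. Qed.

Lemma mact_GLs a b c d :
  mact GLs (vec4 a b c d) = vec4 (a + d) (b + d) (c + d) (d).
Proof. by rewrite mact_gl4 /=; congr vec4; ring. Qed.

Lemma mact_GLPhi1 a b c d :
  mact GLPhi1 (vec4 a b c d) = vec4 (a) (b) (b - c + d) (d).
Proof. by rewrite mact_gl4 /=; congr vec4; ring. Qed.

Lemma mact_GLPhi2 a b c d :
  mact GLPhi2 (vec4 a b c d) = vec4 (a) (a - c + d) (b - c + d) (d).
Proof. by rewrite mact_gl4 /=; congr vec4; ring. Qed.

Lemma mact_GLPsi1 a b c d :
  mact GLPsi1 (vec4 a b c d) = vec4 (a) (b) (c) (c - d).
Proof. by rewrite mact_gl4 /=; congr vec4; ring. Qed.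

Lemma mact_GLPsi2 a b c d :
  mact GLPsi2 (vec4 a b c d) = vec4 (a) (b) (b - d) (c - d).
Proof. by rewrite mact_gl4 /=; congr vec4; ring. Qed.

Lemma mact_GLPsi3 a b c d :
  mact GLPsi3 (vec4 a b c d) = vec4 (a) (a - d) (b - d) (c - d).
Proof. by rewrite mact_gl4 /=; congr vec4; ring. Qed.

Section Products.
Variables (I : eqType) (y : I -> A).

(** The arguments are the tail sums of the list, as produced by the matrix p. *)
Fixpoint Jchain (l : seq I) : ps B :=
  if l is i :: l' then J (\sum_(j <- l) y j) (Jchain l') else 1.

(* The outermost operator of the iterated sum is left unspecified; it will be
   specialized to J and to the constant operator J 0. *)
Variable T : A -> ps B -> ps B.
Hypothesis TD : forall a f g, T a (f + g) = T a f + T a g.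

Let T0 a : T a 0 = 0.
Proof. by apply: (addIr (T a 0)); rewrite -TD !add0r. Qed.

Lemma T_sum a (K : Type) (r : seq K) (F : K -> ps B) :
  T a (\sum_(i <- r) F i) = \sum_(i <- r) T a (F i).
Proof. exact: (big_morph (T a) (TD a) (T0 a)). Qed.

(** Permutations of s are grouped by their first entry x: the outermost
    argument is the same sum for all of them, and the rest runs over the
    permutations of s without x. *)
Lemma T_permutations (s : seq I) : uniq s ->
    (forall x, x \in s ->
      \sum_(l <- permutations (rem x s)) Jchain l
        = \prod_(j <- rem x s) J (y j) 1) -> s != [::] ->
  \sum_(l <- permutations s) T (\sum_(j <- l) y j) (Jchain (behead l)) =
    T (\sum_(j <- s) y j) (\sum_(x <- s) \prod_(j <- rem x s) J (y j) 1).
Proof.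
move=> us IH s0; have sgt : (0 < size s)%N by case: s s0 {us IH}.
rewrite (perm_big _ (permutationsE sgt)) big_allpairs_dep undup_id // T_sum.
apply: eq_big_seq => x xs; rewrite -IH // T_sum.
apply: eq_big_seq => l; rewrite mem_permutations => lP.
congr (T _ _); apply: perm_big; rewrite perm_sym (perm_trans (perm_to_rem xs)) //.
by rewrite perm_cons perm_sym.
Qed.
End Products.

(** Iterating [shuffle]: the largest of the summation indices of a product
    splits off from one of the factors. *)
Lemma prod_J (I : eqType) (y : I -> A) (s : seq I) : uniq s -> s != [::] ->
  \prod_(i <- s) J (y i) 1 =
    J (\sum_(i <- s) y i) (\sum_(x <- s) \prod_(j <- rem x s) J (y j) 1).
Proof.
elim: s => // x [_ _ _|x' s IH].
  by rewrite !big_seq1 /= eqxx big_nil.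
move=> /andP[xs us] _; rewrite big_cons [\sum_(i <- x :: _) y i]big_cons.
rewrite [\sum_(i <- x :: _) _]big_cons /= eqxx -/(rem x (x' :: s)) IH // (shuffle eP).
rewrite mul1r -IH // mulr_sumr; congr (J _ (_ + _)).
apply: eq_big_seq => i ins.
have xi : (x == i) = false by apply: contraNF xs => /eqP ->.
by rewrite /= xi big_cons.
Qed.

(** The full shuffle of words of length one. *)
Lemma prod_permutations (I : eqType) (y : I -> A) (s : seq I) : uniq s ->
  \sum_(l <- permutations s) Jchain y l = \prod_(i <- s) J (y i) 1.
Proof.
have [n] := ubnP (size s); elim: n s => // n IH s /ltnSE les us.
have [->|s0] := eqVneq s [::]; first by rewrite big_seq1 big_nil.
rewrite prod_J // -T_permutations //; last first.
- move=> x xs; apply: IH; last exact: rem_uniq.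
  by rewrite size_rem //; case: (s) xs les.
- by move=> *; exact: JD.
apply: eq_big_seq => l; rewrite mem_permutations.
by case: l => [|//] /perm_size /esym /size0nil sE; rewrite sE eqxx in s0.
Qed.

Section FirstLetter.
Variable T : A -> ps B -> ps B.
Hypothesis TD : forall a f g, T a (f + g) = T a f + T a g.
Implicit Type y : 'I_4 -> A.

Let L1 a := J a 1.
Let L2 a b := J a (J b 1).
Let L3 a b c := J a (J b (J c 1)).

(** The depth four series with its outermost operator replaced by T. *)
Definition Tseries y : ps B := T (y i0) (J (y i1) (J (y i2) (J (y i3) 1))).

Let TseriesE a b c d : Tseries (vec4 a b c d) = T a (L3 b c d).
Proof. by []. Qed.

Lemma shuffle11 a b : L1 a * L1 b = J (a + b) (L1 b) + J (a + b) (L1 a).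
Proof. by rewrite /L1 (shuffle eP) mulr1 mul1r JD. Qed.

Lemma shuffle21 a b c : L2 a b * L1 c =
  L3 (a + c) (b + c) c + L3 (a + c) (b + c) b + L3 (a + c) a b.
Proof. by rewrite /L2 {1}/L1 (shuffle eP) mulr1 -!/(L1 _) shuffle11 !JD. Qed.

Lemma shuffle111 a b c : L1 a * L1 b * L1 c =
  L3 (a + b + c) (b + c) c + L3 (a + b + c) (b + c) b
  + L3 (a + b + c) (a + b) b + L3 (a + b + c) (a + c) c
  + L3 (a + b + c) (a + c) a + L3 (a + b + c) (a + b) a.
Proof. by rewrite shuffle11 mulrDl !shuffle21 !addrA. Qed.

(* Compares two sums of values of T and L3 term by term, the arguments up to
   ring identities. *)
Ltac J_congr := lazymatch goal with
  | |- T _ _ = T _ _ => apply: (f_equal2 T); [ring | J_congr]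
  | |- L3 _ _ _ = L3 _ _ _ => apply: (f_equal3 L3); ring
  | |- _ _ _ = _ _ _ => apply: (f_equal2 +%R); J_congr
  | |- _ => reflexivity
  end.

(** In this lemma and in the next ones for Psi s, Psi Phi q and Phi r, the
    argument of T is the sum of the first letters of the words being shuffled,
    and the series to which T is applied is the sum of the shuffles that remain
    after one of these letters has been removed. *)
Lemma zact_S4 a b c d :
  zact Tseries (zg GLp * Sigma [set: 'S_4]) (vec4 a b c d) =
  T (a + b + c + d)
    (L1 b * L1 c * L1 d + L1 a * L1 c * L1 d
     + L1 a * L1 b * L1 d + L1 a * L1 b * L1 c).
Proof.
set y := vec4 a b c d; rewrite zactM zact_Sigma.
transitivity (\sum_(s : 'S_4)
    T (\sum_(j <- [seq s i | i <- enum 'I_4]) y j)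
      (Jchain y (behead [seq s i | i <- enum 'I_4]))).
  rewrite (sum_perm_inv [set: 'S_4]%G (fun s : 'S_4 => zact _ _ (y \o s))).
  apply: eq_big => [s|s _]; first by rewrite inE.
  rewrite zactG [y \o s]vec4E mact_GLp TseriesE enum4 /L3 /=.
  by rewrite !big_cons !big_nil !addr0 !addrA.
rewrite (sum_permutations (fun l => T (\sum_(j <- l) y j) (Jchain y (behead l)))).
rewrite T_permutations ?enum_uniq ?enum4 //; last first.
  by move=> x _; apply: prod_permutations; rewrite rem_uniq // -enum4 enum_uniq.
by rewrite !big_cons !big_nil !mulr1 !addr0 !addrA !mulrA.
Qed.

Lemma zact_Psi (f : ('I_4 -> A) -> ps B) a b c d : zact f Psi (vec4 a b c d) =
  f (vec4 a b c d) + f (vec4 a b c (c - d)) + f (vec4 a b (b - d) (c - d))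
  + f (vec4 a (a - d) (b - d) (c - d)).
Proof.
by rewrite !zactD zact1 !zactG mact_GLPsi1 mact_GLPsi2 mact_GLPsi3.
Qed.

Lemma zact_Phi (f : ('I_4 -> A) -> ps B) a b c d : zact f Phi (vec4 a b c d) =
  f (vec4 a b c d) + f (vec4 a b (b - c + d) d)
  + f (vec4 a (a - c + d) (b - c + d) d).
Proof. by rewrite !zactD zact1 !zactG mact_GLPhi1 mact_GLPhi2. Qed.

(** The four places of the letter d among a, b, c. *)
Lemma zact_Psi_s a b c d : zact Tseries (Psi * zg GLs) (vec4 a b c d) =
  T (a + d) (L2 b c * L1 d + L3 a b c).
Proof.
rewrite zactM zactG mact_GLs zact_Psi !TseriesE.
rewrite shuffle21 !TD; J_congr.
Qed.

Lemma zact_Psi_Phi_q a b c d :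
  zact Tseries (Psi * Phi * zg GLq) (vec4 a b c d) =
  T (a + c + d) (L1 b * L1 c * L1 d + L2 a b * L1 c + L2 a b * L1 d).
Proof.
rewrite zactM zactG zactM mact_GLq zact_Phi !zact_Psi !TseriesE.
(* The twelve shuffles of the words ab, c and d, without their common first
   argument, in the order in which Psi and Phi produce them. *)
transitivity (T (a + c + d) (
    L3 (b + c + d) (c + d) d + L3 (b + c + d) (c + d) c
    + L3 (b + c + d) (b + c) c + L3 (a + c) (b + c) c
    + (L3 (b + c + d) (b + d) d + L3 (b + c + d) (b + d) b
    + L3 (b + c + d) (b + c) b + L3 (a + c) (b + c) b)
    + (L3 (a + d) (b + d) d + L3 (a + d) (b + d) b + L3 (a + d) a b
    + L3 (a + c) a b))).
  rewrite !TD; J_congr.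
rewrite shuffle111 !shuffle21; congr (T _ _); ring.
Qed.

(** Phi r produces the shuffles of the words ab and cd that end with d; those
    that end with b are the image of these under (13)(24). *)
Lemma zact_Phi_r a b c d :
  zact Tseries (Phi * zg GLr) (vec4 a b c d)
  + zact Tseries (Phi * zg GLr) (vec4 c d a b) =
  T (a + c) (L2 c d * L1 b + L2 a b * L1 d).
Proof.
rewrite !zactM !zactG !mact_GLr !zact_Phi !TseriesE.
transitivity (T (a + c) (
    L3 (c + b) c d + L3 (c + b) (d + b) d + L3 (a + d) (b + d) d
    + (L3 (a + d) a b + L3 (a + d) (b + d) b + L3 (c + b) (d + b) b))).
  rewrite !TD; J_congr.
rewrite !shuffle21; congr (T _ _); ring.
Qed.

Definition cyclic_sum (F : A -> A -> A -> A -> ps B) a b c d : ps B :=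
  F a b c d + F b c d a + F c d a b + F d a b c.

Lemma zact_C4 (f : ('I_4 -> A) -> ps B) x a b c d :
  zact f (x * Sigma C4) (vec4 a b c d) =
    cyclic_sum (fun a b c d => zact f x (vec4 a b c d)) a b c d.
Proof.
rewrite zactM zact_Sigma.
rewrite (sum_perm_inv [group of C4] (fun s : 'S_4 => zact f x (vec4 a b c d \o s))) sum_C4.
have E k : vec4 a b c d \o (cycle4 ^+ k)%g = iter k (fun y => y \o cycle4) (vec4 a b c d).
  elim: k => [|k IH]; first by apply: funext => i; rewrite /= perm1.
  by rewrite iterS -IH; apply: funext => i; rewrite /= expgS permM.
by rewrite -(expg0 cycle4) -{2}(expg1 cycle4) !E /= !vec4_cycle.
Qed.

Let regroup (V : comNzRingType) (P a1 a2 a3 a4 r1 r2 r3 r4 s1 s2 s3 s4 t1 t2 t3 t4 : V) :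
  P - (a1 - r1 - s1 + t1 + (a2 - r2 - s2 + t2) + (a3 - r3 - s3 + t3)
       + (a4 - r4 - s4 + t4)) =
  P - (a1 + a2 + a3 + a4) + (r1 + r3 + (r2 + r4)) + (s1 + s2 + s3 + s4)
    - (t1 + t2 + t3 + t4).
Proof. ring. Qed.

Lemma zact_Omega a b c d : zact Tseries Omega (vec4 a b c d) =
  T (a + b + c + d)
    (L1 b * L1 c * L1 d + L1 a * L1 c * L1 d
     + L1 a * L1 b * L1 d + L1 a * L1 b * L1 c)
  - cyclic_sum (fun a b c d => T (a + c + d)
      (L1 b * L1 c * L1 d + L2 a b * L1 c + L2 a b * L1 d)) a b c d
  + (T (a + c) (L2 c d * L1 b + L2 a b * L1 d)
     + T (b + d) (L2 d a * L1 c + L2 b c * L1 a))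
  + cyclic_sum (fun a b c d => T (a + d) (L2 b c * L1 d + L3 a b c)) a b c d
  - cyclic_sum (fun a b c d => T a (L3 b c d)) a b c d.
Proof.
rewrite zactD zactN zact_S4 zact_C4 -zact_Phi_r -(zact_Phi_r b c d a) /cyclic_sum.
rewrite !(zactD, zactN) !zact1 !zact_Psi_Phi_q !zact_Psi_s !TseriesE.
exact: regroup.
Qed.

End FirstLetter.

Local Notation L1 a := (J a 1).
Local Notation L2 a b := (J a (J b 1)).
Local Notation L3 a b c := (J a (J b (J c 1))).
Local Notation L4 a b c d := (J a (J b (J c (J d 1)))).

Lemma J_L1_L1 a b : L1 a * L1 b = J (a + b) (L1 b + L1 a).
Proof. by rewrite (shuffle eP) mulr1 mul1r. Qed.

Lemma J_L1_L1_L1_L1 a b c d : L1 a * L1 b * L1 c * L1 d =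
  J (a + b + c + d) (L1 b * L1 c * L1 d + L1 a * L1 c * L1 d
     + L1 a * L1 b * L1 d + L1 a * L1 b * L1 c).
Proof.
have E3 : L1 a * L1 b * L1 c
    = J (a + b + c) (L1 b * L1 c + L1 a * L1 c + L1 a * L1 b).
  by rewrite {1}J_L1_L1 (shuffle eP) -J_L1_L1 mulr1 mulrDl.
by rewrite {1}E3 (shuffle eP) -E3 mulr1 !mulrDl.
Qed.

Lemma J_L2_L1_L1 a b c d : L2 a b * L1 c * L1 d =
  J (a + c + d) (L1 b * L1 c * L1 d + L2 a b * L1 c + L2 a b * L1 d).
Proof.
have E3 : L2 a b * L1 c = J (a + c) (L1 b * L1 c + L2 a b).
  by rewrite (shuffle eP) mulr1.
by rewrite {1}E3 (shuffle eP) -E3 mulr1 mulrDl -!addrA [_ * L1 d + _ * L1 c]addrC.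
Qed.

Lemma J_L2_L2 a b c d :
  L2 a b * L2 c d = J (a + c) (L2 c d * L1 b + L2 a b * L1 d).
Proof. by rewrite (shuffle eP) [L1 b * _]mulrC. Qed.

Lemma J_L3_L1 a b c d : L3 a b c * L1 d = J (a + d) (L2 b c * L1 d + L3 a b c).
Proof. by rewrite (shuffle eP) mulr1. Qed.

(** The alternating sum over the proper subsets of edges of the 4-cycle. There
    are only two products for the pairs of opposite edges. *)
Definition cyclic_alt a b c d : ps B :=
  L1 a * L1 b * L1 c * L1 d
  - cyclic_sum (fun a b c d => L2 a b * L1 c * L1 d) a b c d
  + (L2 a b * L2 c d + L2 b c * L2 d a)
  + cyclic_sum (fun a b c d => L3 a b c * L1 d) a b c d
  - cyclic_sum (fun a b c d => L4 a b c d) a b c d.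

Lemma zact_Omega_J a b c d : zact (Tseries J) Omega (vec4 a b c d) = cyclic_alt a b c d.
Proof.
rewrite (zact_Omega (@JD A B e)).
rewrite /cyclic_alt /cyclic_sum J_L1_L1_L1_L1 (J_L2_L2 a b c d) (J_L2_L2 b c d a).
rewrite (J_L2_L1_L1 a b c d) (J_L2_L1_L1 b c d a) (J_L2_L1_L1 c d a b).
rewrite (J_L2_L1_L1 d a b c) (J_L3_L1 a b c d) (J_L3_L1 b c d a).
by rewrite (J_L3_L1 c d a b) (J_L3_L1 d a b c).
Qed.

(** The terms with l_1 = 1 cancel: when T ignores its argument, the series to
    which it is applied in [zact_Omega] add up to zero, because a product and its
    cyclic shifts occur with opposite signs. *)
Lemma zact_Omega_J0 a b c d :
  zact (Tseries (fun=> J 0)) Omega (vec4 a b c d) = 0.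
Proof.
rewrite (zact_Omega (fun _ : A => @JD A B e 0)).
have J00 : J 0 0 = 0 by apply: psP => N; rewrite JE mulr0 mulr0.
have J0N f : J 0 (- f) = - J 0 f by apply/eqP; rewrite -addr_eq0 -JD addNr J00.
rewrite /cyclic_sum -!(JD, J0N) -[RHS]J00; congr (J 0 _).
move: (L1 a) (L1 b) (L1 c) (L1 d) (L2 a b) (L2 b c) (L2 c d) (L2 d a).
move: (L3 a b c) (L3 b c d) (L3 c d a) (L3 d a b) => *.
ring.
Qed.

(** The difference of the two outermost operators is the part of L_4 with
    l_1 >= 2. *)
Lemma zact_Omega_J_J0 a b c d :
  zact (fun y => Tseries J y - Tseries (fun=> J 0) y) Omega (vec4 a b c d)
    = cyclic_alt a b c d.
Proof.
rewrite -zact_Omega_J -[RHS]subr0 -(zact_Omega_J0 a b c d) /zact -sumrB.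
by apply: eq_bigr => M _; rewrite mulrzBl.
Qed.
End Depth4.

(** * Expansion of the series as sums over a box *)

Section PsMonomials.
Variable B : comNzRingType.
Implicit Types (f g : ps B) (c : B).

Definition psC c : ps B := Ps (fun N => if N == 0%N then c else 0).

Lemma psCM c f N : (psC c * f) N = c * f N.
Proof.
by rewrite psME big_ord_recl /= subn0 big1 ?addr0 // => i _; rewrite mul0r.
Qed.

Lemma psMC c f N : (f * psC c) N = f N * c.
Proof. by rewrite mulrC psCM mulrC. Qed.

Lemma psC_mul c c' : psC c * psC c' = psC (c * c').
Proof. by apply: psP => -[|N]; rewrite psCM //= mulr0. Qed.

Lemma psC_zmod : zmod_morphism psC.
Proof. by move=> c c'; apply: psP => -[|N] //=; rewrite subr0. Qed.
HB.instance Definition _ :=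
  GRing.isZmodMorphism.Build B (ps B) psC psC_zmod.

Lemma psC_monoid : monoid_morphism psC.
Proof. by split=> [|c c']; [apply: psP => -[] | rewrite psC_mul]. Qed.
HB.instance Definition _ :=
  GRing.isMonoidMorphism.Build B (ps B) psC psC_monoid.

Definition pspoly (p : {poly int}) : ps B := Ps (fun N => (p`_N)%:~R).

Lemma pspolyE p N : pspoly p N = (p`_N)%:~R. Proof. by []. Qed.

Lemma pspoly_zmod : zmod_morphism pspoly.
Proof. by move=> p q; apply: psP => N /=; rewrite coefB rmorphB. Qed.
HB.instance Definition _ :=
  GRing.isZmodMorphism.Build {poly int} (ps B) pspoly pspoly_zmod.

Lemma pspoly_monoid : monoid_morphism pspoly.
Proof.
split=> [|p q]; apply: psP => N /=; first by rewrite coef1; case: (N).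
by rewrite coefM rmorph_sum; apply: eq_bigr => i _; rewrite rmorphM.
Qed.
HB.instance Definition _ :=
  GRing.isMonoidMorphism.Build {poly int} (ps B) pspoly pspoly_monoid.

Definition eq_upto (K : nat) f g := forall N, (N <= K)%N -> f N = g N.

Variable K : nat.
Local Notation "f =K g" := (eq_upto K f g) (at level 70).

Lemma eq_uptoD f f' g g' : f =K f' -> g =K g' -> f + g =K f' + g'.
Proof. by move=> ff gg N NK; rewrite !psDE ff ?gg. Qed.

Lemma eq_uptoN f f' : f =K f' -> - f =K - f'.
Proof. by move=> ff N NK /=; rewrite ff. Qed.

Lemma eq_uptoM f f' g g' : f =K f' -> g =K g' -> f * g =K f' * g'.
Proof.
move=> ff gg N NK; rewrite !psME; apply: eq_bigr => -[i /= iN] _.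
by rewrite ff ?gg //; lia.
Qed.

Lemma eq_upto_prod I (r : seq I) (F G : I -> ps B) :
  (forall i, F i =K G i) -> \prod_(i <- r) F i =K \prod_(i <- r) G i.
Proof.
move=> FG; elim: r => [|i r IH]; first by rewrite !big_nil.
by rewrite !big_cons; apply: eq_uptoM.
Qed.

Lemma eq_upto_expand f :
  f =K \sum_(j < K.+1) psC (f j) * pspoly 'X^j.
Proof.
move=> N NK; rewrite ps_sumE (bigD1 (Ordinal (NK : N < K.+1)%N)) //.
rewrite psCM pspolyE coefXn eqxx mulr1 big1 => [|i iN]; first by rewrite /= addr0.
rewrite psCM pspolyE coefXn (_ : (N == i) = false) ?mulr0 //.
by apply: contraNF iN => /eqP NE; apply/eqP/val_inj.
Qed.

End PsMonomials.

Lemma eq_upto_trans (B : comNzRingType) K (f g h : ps B) :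
  eq_upto K f g -> eq_upto K g h -> eq_upto K f h.
Proof. by move=> fg gh N NK; rewrite fg ?gh. Qed.

(** Modulo t ^ (d + 1) each factor is a polynomial, and expanding the product
    of the polynomials gives a sum over functions from 'I_n to 'I_d.+1; those
    of total d are the multi-indices of degree d. *)
Lemma ps_prod_coef (B : comNzRingType) n (g : 'I_n -> ps B) d :
  (\prod_i g i) d =
    \sum_(k : 'X_{1..n < d.+1} | mdeg k == d) \prod_i g i (bmnm k i).
Proof.
have /(_ d (leqnn d)) -> := eq_upto_prod (index_enum _) (fun i => @eq_upto_expand _ d (g i)).
rewrite bigA_distr_bigA ps_sumE.
have prodE (f : {ffun 'I_n -> 'I_d.+1}) :
    (\prod_i (psC (g i (f i)) * pspoly B 'X^(f i))) d
      = if (\sum_i f i == d)%N then \prod_i g i (f i) else 0.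
  have -> : \prod_i (psC (g i (f i)) * pspoly B 'X^(f i))
      = psC (\prod_i g i (f i)) * pspoly B 'X^(\sum_i f i).
    rewrite big_split /= -(rmorph_prod (pspoly B)) prodrXr.
    by rewrite rmorph_prod.
  by rewrite psCM pspolyE coefXn eq_sym; case: eqP => _; rewrite ?mulr1 ?mulr0.
rewrite (eq_bigr _ (fun f _ => prodE f)).
rewrite -big_mkcond /=.
pose F (k : 'X_{1..n < d.+1}) : {ffun 'I_n -> 'I_d.+1} := [ffun i => inord (bmnm k i)].
have kle (k : 'X_{1..n < d.+1}) i : (bmnm k i < d.+1)%N.
  apply: leq_ltn_trans (bmdeg k); rewrite mdegE (bigD1 i) //=; exact: leq_addr.
rewrite (reindex F) /=.
  apply: eq_big => [k|k _].
    by rewrite mdegE; congr (_ == d); apply: eq_bigr => i _; rewrite ffunE inordK.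
  by apply: eq_bigr => i _; rewrite ffunE inordK.
have GP (f : {ffun 'I_n -> 'I_d.+1}) : (\sum_i f i == d)%N ->
    (mdeg [multinom f i : nat | i < n] < d.+1)%N.
  by rewrite mdegE => /eqP fd; under eq_bigr do rewrite mnmE; rewrite fd.
exists (fun f : {ffun 'I_n -> 'I_d.+1} => insubd (@bm0 n d) [multinom f i : nat | i < n]) => [k _|f fd].
  apply: val_inj; rewrite /= insubdK.
    by apply/mnmP => i; rewrite mnmE ffunE inordK.
  rewrite -topredE /=; apply: leq_ltn_trans (bmdeg k).
  by rewrite !mdegE; apply: leq_sum => i _; rewrite mnmE ffunE inordK.
have fdE := insubdK (@bm0 n d) (GP f fd).
by apply/ffunP => i; rewrite ffunE; move: fdE => /= ->; rewrite mnmE inord_val.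
Qed.

(** Indices run over 'I_K and stand for the positive integers 1, ..., K, so the
    index m comes with t ^ m.+1. *)
Definition tmon (B : comNzRingType) (m : nat) : ps B := pspoly B 'X^(m.+1).

Lemma tmonE (B : comNzRingType) m N : tmon B m N = (N == m.+1)%:R.
Proof. by rewrite /tmon pspolyE coefXn mulrz_nat. Qed.

Section Box.
Variables (A B : comNzRingType) (e : nat -> A -> B) (K : nat).
Implicit Types (a b c d : A) (f g h : ps B).
Local Notation J := (J e).
Local Notation "f =K g" := (eq_upto K f g) (at level 70).
Local Notation t m := (tmon B m).
Local Notation E a m := (psC (e m.+1 a)).
Local Notation lt n m := ((n < m)%N%:R : ps B).

Lemma J1_box a : J a 1 =K \sum_(m < K) t m * E a m.
Proof.
move=> N NK; rewrite JE tsumE ps_sumE; case: N NK => [|N] NK.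
  rewrite big_ord0 mulr0 big1 // => m _.
  by rewrite psMC tmonE mul0r.
have -> : \sum_(i < N.+1) (1 : ps B) i = 1.
  by rewrite big_ord_recl big1 // addr0.
rewrite mulr1 (bigD1 (Ordinal NK)) // psMC tmonE eqxx mul1r.
rewrite big1 => [|m mN]; first by rewrite /= addr0.
rewrite psMC tmonE eqSS (_ : (N == m) = false) ?mul0r //.
by apply: contraNF mN => /eqP NE; apply/eqP/val_inj.
Qed.

Lemma J_box a f (c : nat -> B) : f =K \sum_(n < K) t n * psC (c n) ->
  J a f =K \sum_(m < K) t m * psC (e m.+1 a * \sum_(n < K | (n < m)%N) c n).
Proof.
move=> fE N NK; rewrite JE tsumE ps_sumE; case: N NK => [|N] NK.
  rewrite big_ord0 mulr0 big1 // => m _.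
  by rewrite psMC tmonE mul0r.
rewrite (bigD1 (Ordinal NK)) // psMC tmonE eqxx mul1r.
rewrite [\sum_(m < K | m != _) _]big1 => [|m mN]; last first.
  rewrite psMC tmonE eqSS (_ : (N == m) = false) ?mul0r //.
  by apply: contraNF mN => /eqP NE; apply/eqP/val_inj.
rewrite /= addr0; congr (_ * _).
transitivity (\sum_(i < N.+1) \sum_(n < K) (i == n.+1 :> nat)%:R * c n).
  apply: eq_bigr => i _; rewrite fE; last by have := ltn_ord i; lia.
  by rewrite ps_sumE; apply: eq_bigr => n _; rewrite psMC tmonE.
rewrite exchange_big [RHS]big_mkcond; apply: eq_bigr => n _ /=.
rewrite -mulr_suml; case: ltnP => [nN|Nn].
  rewrite (bigD1 (Ordinal (nN : n.+1 < N.+1)%N)) //= eqxx big1 ?addr0 ?mul1r //.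
  by move=> i iN; case: eqP => // iE; case/eqP: iN; apply: val_inj.
by rewrite big1 ?mul0r // => i _; case: eqP => // iE; have := ltn_ord i; lia.
Qed.

Lemma psC_step x (m : nat) (c : nat -> B) :
  psC (x * \sum_(n < K | (n < m)%N) c n)
    = \sum_(n < K) lt n m * (psC x * psC (c n)).
Proof.
rewrite big_mkcond mulr_sumr rmorph_sum; apply: eq_bigr => n _.
by case: ltnP => _; rewrite ?mulr0 ?rmorph0 ?mulr0n ?mul0r ?mulr1n ?mul1r ?rmorphM.
Qed.

(* The coefficients of the iterated sums, as nested sums. *)
Let chain1 a m := e m.+1 a.
Let chain2 a b m := e m.+1 a * \sum_(n < K | (n < m)%N) chain1 b n.
Let chain3 a b c m := e m.+1 a * \sum_(n < K | (n < m)%N) chain2 b c n.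

Let J1_chain a := J1_box a : J a 1 =K \sum_(m < K) t m * psC (chain1 a m).
Let J2_chain a b := @J_box a _ (chain1 b) (J1_chain b).
Let J3_chain a b c := @J_box a _ (chain2 b c) (J2_chain b c).
Let J4_chain a b c d := @J_box a _ (chain3 b c d) (J3_chain b c d).

Lemma J2_box a b : J a (J b 1) =K
  \sum_(m < K) \sum_(n < K) (lt n m * t m) * (E a m * E b n).
Proof.
apply: eq_upto_trans (J2_chain a b) _ => N _; apply: (congr1 (fun f : ps B => f N)).
apply: eq_bigr => m _; rewrite psC_step mulr_sumr; apply: eq_bigr => n _; ring.
Qed.

Lemma J3_box a b c : J a (J b (J c 1)) =K
  \sum_(m < K) \sum_(n < K) \sum_(p < K)
    (lt n m * lt p n * t m) * (E a m * E b n * E c p).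
Proof.
apply: eq_upto_trans (J3_chain a b c) _ => N _.
apply: (congr1 (fun f : ps B => f N)).
apply: eq_bigr => m _; rewrite psC_step mulr_sumr; apply: eq_bigr => n _.
rewrite psC_step !mulr_sumr; apply: eq_bigr => p _; ring.
Qed.

Definition sum_box (V : nmodType) (F : nat -> nat -> nat -> nat -> V) : V :=
  \sum_(m < K) \sum_(n < K) \sum_(p < K) \sum_(q < K) F m n p q.

Lemma L4_box a b c d : J a (J b (J c (J d 1))) =K
  sum_box (fun m n p q =>
    (lt n m * lt p n * lt q p * t m) * (E a m * E b n * E c p * E d q)).
Proof.
apply: eq_upto_trans (J4_chain a b c d) _ => N _.
apply: (congr1 (fun f : ps B => f N)).
apply: eq_bigr => m _; rewrite psC_step mulr_sumr; apply: eq_bigr => n _.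
rewrite psC_step !mulr_sumr; apply: eq_bigr => p _.
rewrite psC_step !mulr_sumr; apply: eq_bigr => q _; ring.
Qed.

(** Cyclic shifts of the variables become cyclic shifts of the indices. *)
Lemma sum_box_rot (V : nmodType) (F : nat -> nat -> nat -> nat -> V) :
  sum_box (fun m n p q => F n p q m) = sum_box F.
Proof.
rewrite /sum_box; transitivity (\sum_(n < K) \sum_(m < K) \sum_(p < K) \sum_(q < K) F n p q m).
  exact: exchange_big.
apply: eq_bigr => n _.
transitivity (\sum_(p < K) \sum_(m < K) \sum_(q < K) F n p q m).
  exact: exchange_big.
by apply: eq_bigr => p _; exact: exchange_big.
Qed.

Lemma sum_box22 (f g : nat -> nat -> ps B) :
  (\sum_(m < K) \sum_(n < K) f m n) * (\sum_(p < K) \sum_(q < K) g p q)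
    = sum_box (fun m n p q => f m n * g p q).
Proof.
rewrite /sum_box mulr_suml; apply: eq_bigr => m _; rewrite mulr_suml.
apply: eq_bigr => n _; rewrite mulr_sumr; apply: eq_bigr => p _.
by rewrite mulr_sumr.
Qed.

Lemma sum_box31 (f : nat -> nat -> nat -> ps B) (g : nat -> ps B) :
  (\sum_(m < K) \sum_(n < K) \sum_(p < K) f m n p) * (\sum_(q < K) g q)
    = sum_box (fun m n p q => f m n p * g q).
Proof.
rewrite /sum_box mulr_suml; apply: eq_bigr => m _; rewrite mulr_suml.
apply: eq_bigr => n _; rewrite mulr_suml; apply: eq_bigr => p _.
by rewrite mulr_sumr.
Qed.

Lemma sum_box11 (f g : nat -> ps B) :
  (\sum_(m < K) f m) * (\sum_(n < K) g n) = \sum_(m < K) \sum_(n < K) f m * g n.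
Proof. by rewrite mulr_suml; apply: eq_bigr => m _; rewrite mulr_sumr. Qed.

Lemma sum_boxD (V : zmodType) (F G : nat -> nat -> nat -> nat -> V) :
  sum_box F + sum_box G = sum_box (fun m n p q => F m n p q + G m n p q).
Proof.
rewrite /sum_box -big_split; apply: eq_bigr => m _; rewrite -big_split.
by apply: eq_bigr => n _; rewrite -big_split; apply: eq_bigr => p _; rewrite -big_split.
Qed.

Lemma sum_boxN (V : zmodType) (F : nat -> nat -> nat -> nat -> V) :
  - sum_box F = sum_box (fun m n p q => - F m n p q).
Proof.
rewrite /sum_box -sumrN; apply: eq_bigr => m _; rewrite -sumrN.
by apply: eq_bigr => n _; rewrite -sumrN; apply: eq_bigr => p _; rewrite -sumrN.
Qed.

Lemma eq_sum_box (V : nmodType) (F G : nat -> nat -> nat -> nat -> V) :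
  (forall m n p q, (m < K)%N -> (n < K)%N -> (p < K)%N -> (q < K)%N ->
    F m n p q = G m n p q) ->
  sum_box F = sum_box G.
Proof.
move=> FG; apply: eq_bigr => m _; apply: eq_bigr => n _; apply: eq_bigr => p _.
by apply: eq_bigr => q _; apply: FG.
Qed.

Let B1 a m := t m * E a m.
Let B2 a b m n := (lt n m * t m) * (E a m * E b n).
Let B3 a b c m n p := (lt n m * lt p n * t m) * (E a m * E b n * E c p).
Let B11 a b m n := B1 a m * B1 b n.

Let J11_box a b : J a 1 * J b 1 =K \sum_(m < K) \sum_(n < K) B11 a b m n.
Proof.
have := eq_uptoM (J1_box a) (J1_box b).
by rewrite (sum_box11 (B1 a) (B1 b)).
Qed.

Lemma L1111_box a b c d : J a 1 * J b 1 * J c 1 * J d 1 =K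
  sum_box (fun m n p q => (t m * t n * t p * t q) * (E a m * E b n * E c p * E d q)).
Proof.
rewrite -!mulrA mulrA; have := eq_uptoM (J11_box a b) (J11_box c d).
rewrite sum_box22; congr (eq_upto _ _ _); apply: eq_sum_box => m n p q _ _ _ _.
by rewrite /B11 /B1; ring.
Qed.

Lemma L211_box a b c d : J a (J b 1) * J c 1 * J d 1 =K
  sum_box (fun m n p q => (lt n m * t m * t p * t q) * (E a m * E b n * E c p * E d q)).
Proof.
rewrite -mulrA; have := eq_uptoM (J2_box a b) (J11_box c d).
rewrite (sum_box22 (B2 a b)); congr (eq_upto _ _ _).
by apply: eq_sum_box => m n p q _ _ _ _; rewrite /B2 /B11 /B1; ring.
Qed.

Lemma L22_box a b c d : J a (J b 1) * J c (J d 1) =K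
  sum_box (fun m n p q => (lt n m * lt q p * t m * t p) * (E a m * E b n * E c p * E d q)).
Proof.
have := eq_uptoM (J2_box a b) (J2_box c d).
rewrite (sum_box22 (B2 a b) (B2 c d)); congr (eq_upto _ _ _).
by apply: eq_sum_box => m n p q _ _ _ _; rewrite /B2; ring.
Qed.

Lemma L31_box a b c d : J a (J b (J c 1)) * J d 1 =K
  sum_box (fun m n p q => (lt n m * lt p n * t m * t q) * (E a m * E b n * E c p * E d q)).
Proof.
have := eq_uptoM (J3_box a b c) (J1_box d).
rewrite (sum_box31 (B3 a b c) (B1 d)); congr (eq_upto _ _ _).
by apply: eq_sum_box => m n p q _ _ _ _; rewrite /B3 /B1; ring.
Qed.

(** The numerator of the inclusion-exclusion. Expanding it gives one monomial
    for each set of edges: an edge m > n contributes the condition n < m and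
    removes the index n from the exponent of t. *)
Definition cyc_poly (m n p q : nat) : {poly int} :=
  ('X^(n.+1) - (n < m)%N%:R) * ('X^(p.+1) - (p < n)%N%:R)
  * ('X^(q.+1) - (q < p)%N%:R) * ('X^(m.+1) - (m < q)%N%:R).

Lemma cyclic_box (F : A -> A -> A -> A -> ps B) (w : nat -> nat -> nat -> nat -> ps B) a b c d :
  (forall a b c d, F a b c d =K
    sum_box (fun m n p q => w m n p q * (E a m * E b n * E c p * E d q))) ->
  cyclic_sum F a b c d =K sum_box (fun m n p q =>
     (w m n p q + w n p q m + w p q m n + w q m n p)
     * (E a m * E b n * E c p * E d q)).
Proof.
move=> FE; apply: eq_upto_trans.
  exact: (eq_uptoD (eq_uptoD (eq_uptoD (FE a b c d) (FE b c d a)) (FE c d a b))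
    (FE d a b c)).
move=> N _; apply: (congr1 (fun f : ps B => f N)).
pose G a b c d m n p q := w m n p q * (E a m * E b n * E c p * E d q).
rewrite -(sum_box_rot (G b c d a)) -(sum_box_rot (G c d a b)).
rewrite -(sum_box_rot (fun m n p q => G c d a b n p q m)).
rewrite -(sum_box_rot (G d a b c)).
rewrite -(sum_box_rot (fun m n p q => G d a b c n p q m)).
rewrite -(sum_box_rot (fun m n p q => G d a b c p q m n)).
rewrite !sum_boxD; apply: eq_sum_box => m n p q _ _ _ _; rewrite /G; ring.
Qed.

Lemma cyclic_alt_box a b c d : cyclic_alt e a b c d =K
  sum_box (fun m n p q => pspoly B (cyc_poly m n p q) * (E a m * E b n * E c p * E d q)).
Proof.
have L22 : J a (J b 1) * J c (J d 1) + J b (J c 1) * J d (J a 1) =K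
    sum_box (fun m n p q =>
      (lt n m * lt q p * t m * t p + lt p n * lt m q * t n * t q)
      * (E a m * E b n * E c p * E d q)).
  apply: eq_upto_trans (eq_uptoD (L22_box a b c d) (L22_box b c d a)) _.
  pose G m n p q := (lt n m * lt q p * t m * t p) * (E b m * E c n * E d p * E a q).
  rewrite -(sum_box_rot G) sum_boxD; move=> N _; apply: (congr1 (fun f : ps B => f N)).
  by apply: eq_sum_box => m n p q _ _ _ _; rewrite /G; ring.
have L211 := cyclic_box (F := fun a b c d => J a (J b 1) * J c 1 * J d 1)
  (w := fun m n p q => lt n m * t m * t p * t q) a b c d L211_box.
have L31 := cyclic_box (F := fun a b c d => J a (J b (J c 1)) * J d 1)
  (w := fun m n p q => lt n m * lt p n * t m * t q) a b c d L31_box.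
have L4 := cyclic_box (F := fun a b c d => J a (J b (J c (J d 1))))
  (w := fun m n p q => lt n m * lt p n * lt q p * t m) a b c d L4_box.
have := eq_uptoD (eq_uptoD (eq_uptoD (eq_uptoD (L1111_box a b c d)
  (eq_uptoN L211)) L22) L31) (eq_uptoN L4).
rewrite !(sum_boxN, sum_boxD); congr (eq_upto _ _ _).
apply: eq_sum_box => m n p q _ _ _ _.
rewrite -!mulNr -!mulrDl; congr (_ * _).
rewrite /cyc_poly !rmorphM !rmorphB /= !rmorph_nat -!/(tmon B _).
(* The set of all edges, which is absent from cyclic_alt. *)
have cyc0 : lt n m * lt p n * lt q p * lt m q = 0.
  rewrite -!natrM !mulnb; case: ltnP => //= nm; case: ltnP => //= pn.
  by case: ltnP => //= qp; case: ltnP => //= mq; lia.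
rewrite -[LHS]addr0 -[X in _ + X]cyc0; ring.
Qed.
End Box.

Lemma sum_box_zero (V : nmodType) K :
  sum_box K (fun _ _ _ _ => 0) = 0 :> V.
Proof. by rewrite /sum_box; do 4![apply: big1 => ? _]. Qed.

Lemma sum_box_morph (V W : nmodType) (phi : {additive V -> W}) K F :
  phi (sum_box K F) = sum_box K (fun m n p q => phi (F m n p q)).
Proof.
rewrite /sum_box raddf_sum; apply: eq_bigr => m _; rewrite raddf_sum.
apply: eq_bigr => n _; rewrite raddf_sum; apply: eq_bigr => p _.
exact: raddf_sum.
Qed.

Lemma ps_sum_box (S : zmodType) K (F : nat -> nat -> nat -> nat -> ps S) N :
  (sum_box K F) N = sum_box K (fun m n p q => F m n p q N).
Proof. exact: (sum_box_morph (psco N)). Qed.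

Lemma sum_box_sum (V : nmodType) K I (r : seq I) (P : pred I)
    (F : I -> nat -> nat -> nat -> nat -> V) :
  sum_box K (fun m n p q => \sum_(i <- r | P i) F i m n p q)
    = \sum_(i <- r | P i) sum_box K (F i).
Proof.
rewrite /sum_box [RHS]exchange_big; apply: eq_bigr => m _.
rewrite [RHS]exchange_big; apply: eq_bigr => n _.
by rewrite [RHS]exchange_big; apply: eq_bigr => p _; rewrite exchange_big.
Qed.

Section BoxCoef.
Variables (A B : comNzRingType) (e : nat -> A -> B) (K N : nat).
Hypothesis NK : (N <= K)%N.
Implicit Types (a b c d : A).
Local Notation J := (J e).

Let psC4 (x y z w : B) : psC x * psC y * psC z * psC w = psC (x * y * z * w).
Proof. by rewrite !rmorphM. Qed.

Lemma L4_coef a b c d : J a (J b (J c (J d 1))) N = sum_box K (fun m n p q =>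
    ((n < m)%N * (p < n)%N * (q < p)%N * (N == m.+1))%:R
    * (e m.+1 a * e n.+1 b * e p.+1 c * e q.+1 d)).
Proof.
rewrite (L4_box _ _ _ _ _ NK) ps_sum_box; apply: eq_sum_box => m n p q _ _ _ _.
rewrite psC4 psMC; congr (_ * _).
by rewrite -!natrM -(rmorph_nat (@psC B)) psCM tmonE -natrM.
Qed.

Lemma cyclic_alt_coef a b c d : cyclic_alt e a b c d N = sum_box K (fun m n p q =>
    ((cyc_poly m n p q)`_N)%:~R * (e m.+1 a * e n.+1 b * e p.+1 c * e q.+1 d)).
Proof.
rewrite (cyclic_alt_box _ _ _ _ _ NK) ps_sum_box; apply: eq_sum_box => m n p q _ _ _ _.
by rewrite psC4 psMC pspolyE.
Qed.

Lemma Tseries_diff_coef (y : 'I_4 -> A) :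
  (Tseries e J y - Tseries e (fun=> J 0) y) N = sum_box K (fun m n p q =>
    ((n < m)%N * (p < n)%N * (q < p)%N * (N == m.+1))%:R
    * ((e m.+1 (y i0) - e m.+1 0) * e n.+1 (y i1) * e p.+1 (y i2) * e q.+1 (y i3))).
Proof.
rewrite [LHS](_ : _ = Tseries e J y N - Tseries e (fun=> J 0) y N) // {1}/Tseries.
rewrite L4_coef {1}/Tseries L4_coef sum_boxN sum_boxD.
by apply: eq_sum_box => m n p q _ _ _ _; ring.
Qed.
End BoxCoef.

(** * Coefficients of the action *)

Section GeometricSeries.
Variables (F : numFieldType) (A : comAlgType F).
Implicit Types (a : A).

(** The linear forms are multiplied by an auxiliary variable z, and [ps A] is
    here the ring of power series in z. This makes 1 / (N - z a) a geometric
    series, and the power of z records the degree of a monomial. *)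
Definition zscale a : ps A := Ps (fun d => if d == 1%N then a else 0).

Lemma zscale_zmod : zmod_morphism zscale.
Proof. by move=> a b; apply: psP => d /=; case: eqP => //; rewrite subr0. Qed.
HB.instance Definition _ :=
  GRing.isZmodMorphism.Build A (ps A) zscale zscale_zmod.

Definition zgeom (N : nat) a : ps A := Ps (fun d => (N%:R : F) ^- d.+1 *: a ^+ d).

Lemma zgeomP N a : (0 < N)%N -> (N%:R - zscale a) * zgeom N a = 1.
Proof.
move=> N0; have Nu : (N%:R : F) != 0 by rewrite pnatr_eq0 -lt0n.
have zE d : (zscale a * zgeom N a) d.+1 = a * zgeom N a d.
  rewrite psME big_ord_recl mul0r add0r big_ord_recl /= subSS subn0.
  by rewrite big1 ?addr0 // => i _; rewrite mul0r.
have z0 : (zscale a * zgeom N a) 0%N = 0.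
  by rewrite psME big_ord_recl big_ord0 mul0r addr0.
have NE d : (N%:R * zgeom N a) d = (N%:R : F) ^- d *: a ^+ d.
  rewrite -(rmorph_nat (@psC A)) psCM mulr_natl /= -scaler_nat scalerA.
  by rewrite exprS invfM mulrA mulfV // mul1r.
have psNE f d : (- f : ps A) d = - f d by [].
apply: psP => -[|d]; rewrite mulrBl psDE NE psNE.
  by rewrite z0 subr0 !expr0 invr1 scale1r.
by rewrite zE [zgeom _ _ _]/= -scalerAr -exprS subrr.
Qed.

End GeometricSeries.

Section ActCoef.
Variables (n : nat) (R : numFieldType).
Implicit Types (f : fps n R) (M : GL n) (k : 'X_{1..n}).

Definition mvars : 'I_n -> {mpoly R[n]} := fun i => 'X_i.

Lemma GL_formE M i : GL_form R M i = mact M mvars i.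
Proof. by rewrite /GL_form /mact; apply: eq_bigr => j _; rewrite scaler_int. Qed.

Lemma GL_form_homog M i : mact M mvars i \is 1%N.-homog.
Proof.
rewrite -GL_formE rpred_sum // => j _; apply: dhomogZ.
by rewrite dhomogX /= mdeg1.
Qed.

Lemma mact_monomial_homog M k :
  \prod_i mact M mvars i ^+ k i \is (mdeg k).-homog.
Proof.
rewrite mdegE; elim/big_ind2: _ => [|p d q e|i _]; first exact: dhomog1.
  exact: dhomogM.
by have := dhomogMn (k i) (GL_form_homog M i); rewrite mul1n.
Qed.

(** Linear substitutions preserve the degree, so of the truncation in the
    definition only the homogeneous part of degree mdeg k contributes. *)
Lemma fps_actE f M k : fps_act f M k =
  (\sum_(k' : 'X_{1..n < (mdeg k).+1} | mdeg k' == mdeg k)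
     f k' *: \prod_i mact M mvars i ^+ k' i)@_k.
Proof.
rewrite /fps_act /fps_trunc (raddf_sum (comp_mpoly _)) !(raddf_sum (mcoeff k)).
rewrite [RHS]big_mkcond.
apply: eq_bigr => k' _; rewrite /= comp_mpolyZ comp_mpolyX.
rewrite (eq_bigr (fun i => mact M mvars i ^+ k' i)); last first.
  by move=> i _; rewrite tnth_mktuple GL_formE.
case: eqP => // /eqP k'k.
by rewrite mcoeffZ (dhomog_nemf_coeff (mact_monomial_homog M k')) ?mulr0 // eq_sym.
Qed.

End ActCoef.

Section MonomialCoefs.
Variables (R : numFieldType) (A : comAlgType R).
Local Notation e := (@zgeom R A).
Implicit Types (y : 'I_4 -> A) (k : 'X_{1..4}).

Lemma prod4 (S : comNzRingType) (F : 'I_4 -> S) :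
  \prod_i F i = F i0 * F i1 * F i2 * F i3.
Proof. by rewrite -big_enum enum4 !big_cons big_nil /= mulr1 !mulrA. Qed.

Lemma prod4_coef (g : 'I_4 -> ps A) (c : 'I_4 -> nat -> R) y d :
  (forall i j, g i j = c i j *: y i ^+ j) ->
  (g i0 * g i1 * g i2 * g i3) d =
    \sum_(k : 'X_{1..4 < d.+1} | mdeg k == d)
      (\prod_i c i (bmnm k i)) *: \prod_i y i ^+ bmnm k i.
Proof.
move=> gE; rewrite -prod4 ps_prod_coef; apply: eq_bigr => k _.
by rewrite -scaler_prod; apply: eq_bigr => i _; rewrite gE.
Qed.

Definition weight (m n p q : nat) k : R :=
  m.+1%:R ^- (k i0).+1 * n.+1%:R ^- (k i1).+1 * p.+1%:R ^- (k i2).+1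
  * q.+1%:R ^- (k i3).+1.

Lemma zgeom_prod m n p q y d :
  (e m.+1 (y i0) * e n.+1 (y i1) * e p.+1 (y i2) * e q.+1 (y i3)) d =
    \sum_(k : 'X_{1..4 < d.+1} | mdeg k == d)
      weight m n p q k *: \prod_i y i ^+ bmnm k i.
Proof.
pose l (i : 'I_4) := nth 0%N [:: m; n; p; q] i.
rewrite (@prod4_coef (fun i => e (l i).+1 (y i))
  (fun i j => (l i).+1%:R ^- j.+1) y d) //.
by apply: eq_bigr => k _; rewrite prod4.
Qed.

(** Subtracting the value at argument 0 of the first factor removes the
    monomials without the first variable, that is those with l_1 = 1. *)
Lemma zgeom_prod_adm m n p q y d :
  ((e m.+1 (y i0) - e m.+1 0) * e n.+1 (y i1) * e p.+1 (y i2) * e q.+1 (y i3)) d =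
    \sum_(k : 'X_{1..4 < d.+1} | mdeg k == d)
      (if (0 < bmnm k i0)%N then weight m n p q k else 0)
        *: \prod_i y i ^+ bmnm k i.
Proof.
pose l (i : 'I_4) := nth 0%N [:: m; n; p; q] i.
rewrite (@prod4_coef
  (fun i => if val i == 0%N then e m.+1 (y i) - e m.+1 0 else e (l i).+1 (y i))
  (fun i j => if (val i == 0%N) && (j == 0%N) then 0 else (l i).+1%:R ^- j.+1) y d) //.
  apply: eq_bigr => k _; rewrite prod4 /weight /=; congr (_ *: _).
  by case: (bmnm k i0) => [|j] /=; rewrite ?mul0r.
move=> i j; case: eqP => [iE|] //=.
rewrite /l iE; case: j => [|j] /=; first by rewrite !expr0 subrr scale0r.
by rewrite [0 ^+ _]exprS mul0r scaler0 subr0.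
Qed.

(** For N <= K, the coefficient of t ^ N in the multiple polylogarithms with
    l_1 >= 2. *)
Definition Qcoef (K N : nat) : fps 4 R := fun k =>
  if (0 < k i0)%N then sum_box K (fun m n p q =>
    ((n < m)%N * (p < n)%N * (q < p)%N * (N == m.+1))%:R * weight m n p q k)
  else 0.

Local Notation J := (J e).

Lemma sum_box_scale (V : lmodType R) K (F : nat -> nat -> nat -> nat -> R) (v : V) :
  sum_box K F *: v = sum_box K (fun m n p q => F m n p q *: v).
Proof.
rewrite /sum_box scaler_suml; apply: eq_bigr => m _; rewrite scaler_suml.
apply: eq_bigr => n _; rewrite scaler_suml; apply: eq_bigr => p _.
by rewrite scaler_suml.
Qed.

Lemma psMzE (S : zmodType) (f : ps S) c N : (f *~ c) N = f N *~ c.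
Proof. exact: (raddfMz (psco N)). Qed.

Lemma Tseries_coef K N y d : (N <= K)%N ->
  (Tseries e J y - Tseries e (fun=> J 0) y) N d =
    \sum_(k : 'X_{1..4 < d.+1} | mdeg k == d)
      Qcoef K N k *: \prod_i y i ^+ bmnm k i.
Proof.
move=> NK; rewrite (Tseries_diff_coef e NK) ps_sum_box.
pose c m n p q := ((n < m)%N * (p < n)%N * (q < p)%N * (N == m.+1))%N.
transitivity (sum_box K (fun m n p q =>
  \sum_(k : 'X_{1..4 < d.+1} | mdeg k == d)
    ((c m n p q)%:R * (if (0 < bmnm k i0)%N then weight m n p q k else 0))
      *: \prod_i y i ^+ bmnm k i)).
  apply: eq_sum_box => m n p q _ _ _ _.
  rewrite -(rmorph_nat (@psC _)) psCM zgeom_prod_adm mulr_sumr.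
  by apply: eq_bigr => k _; rewrite mulr_natl -scaler_nat scalerA.
rewrite sum_box_sum; apply: eq_bigr => k _; rewrite -sum_box_scale; congr (_ *: _).
rewrite /Qcoef; case: ltnP => // _; rewrite -[RHS](sum_box_zero R K).
by apply: eq_sum_box => *; rewrite mulr0.
Qed.

Lemma cyclic_alt_zcoef K N y d : (N <= K)%N ->
  cyclic_alt e (y i0) (y i1) (y i2) (y i3) N d = sum_box K (fun m n p q =>
    ((cyc_poly m n p q)`_N)%:~R * \sum_(k : 'X_{1..4 < d.+1} | mdeg k == d)
      weight m n p q k *: \prod_i y i ^+ bmnm k i).
Proof.
move=> NK; rewrite (cyclic_alt_coef e NK) ps_sum_box.
apply: eq_sum_box => m n p q _ _ _ _.
by rewrite -(rmorph_int (@psC A)) psCM zgeom_prod.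
Qed.

End MonomialCoefs.

Section Specialization.
Variable R : numFieldType.
Implicit Types (k : 'X_{1..4}).
Local Notation A := {mpoly R[4]}.

Lemma mcoef_monomials k (c : 'X_{1..4} -> R) :
  (\sum_(k' : 'X_{1..4 < (mdeg k).+1} | mdeg k' == mdeg k)
      c k' *: \prod_i (mvars R i) ^+ bmnm k' i)@_k = c k.
Proof.
rewrite raddf_sum (bigD1 (BMultinom (ltnSn (mdeg k)))) //=.
rewrite mcoeffZ -mpolyXE_id mcoeffX eqxx mulr1 big1 ?addr0 // => k' /andP[_ k'k].
rewrite mcoeffZ -mpolyXE_id mcoeffX (_ : (_ == _) = false) ?mulr0 //.
by apply: contraNF k'k => /eqP kE; apply/eqP/val_inj.
Qed.

(** The theorem at a fixed power of t: an exact identity of finite sums. *)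
Lemma fps_zact_Qcoef K N k : (N <= K)%N ->
  fps_zact (Qcoef R K N) Omega k
    = sum_box K (fun m n p q => ((cyc_poly m n p q)`_N)%:~R * weight R m n p q k).
Proof.
move=> NK; transitivity
  (cyclic_alt (@zgeom R A) (mvars R i0) (mvars R i1) (mvars R i2) (mvars R i3) N (mdeg k))@_k.
  rewrite -(zact_Omega_J_J0 (@zgeomP R A)) -vec4E.
  rewrite /zact ps_sumE ps_sumE (raddf_sum (mcoeff k)) /fps_zact.
  apply: eq_bigr => M _; rewrite fps_actE !psMzE (raddfMz (mcoeff k)) mulrzl.
  by rewrite (Tseries_coef _ _ NK).
rewrite (cyclic_alt_zcoef (mvars R) _ NK) (sum_box_morph (mcoeff k)).
apply: eq_sum_box => m n p q _ _ _ _.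
rewrite !mulrzl (raddfMz (mcoeff k)); congr (_ *~ _).
exact: (mcoef_monomials k (weight R m n p q)).
Qed.
End Specialization.

(** * Sequences tending to zero *)

Section Small.
Variable R : realType.
Implicit Types (u v : nat -> R).

Definition small u := forall eps, 0 < eps ->
  exists J : nat, forall j, (J <= j)%N -> `|u j| <= eps.

Lemma small_le u v : (exists J : nat, forall j, (J <= j)%N -> `|u j| <= v j) ->
  small v -> small u.
Proof.
move=> [J0 uv] sv eps eps0; have [J vJ] := sv eps eps0.
exists (maxn J J0) => j; rewrite geq_max => /andP[jJ jJ0].
by rewrite (le_trans (uv j jJ0)) // (le_trans (ler_norm _)) ?vJ.
Qed.

Lemma small0 : small (fun=> 0).
Proof. by move=> eps /ltW eps0; exists 0%N => j _; rewrite normr0. Qed.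

Lemma smallD u v : small u -> small v -> small (fun j => u j + v j).
Proof.
move=> su sv eps eps0; have e2 : 0 < eps / 2 by rewrite divr_gt0.
have [J uJ] := su _ e2; have [J' vJ] := sv _ e2.
exists (maxn J J') => j; rewrite geq_max => /andP[jJ jJ'].
by rewrite (le_trans (ler_normD _ _)) // [eps]splitr lerD ?uJ ?vJ.
Qed.

Lemma smallZ c u : small u -> small (fun j => c * u j).
Proof.
move=> su eps eps0; have c1 : 0 < `|c| + 1 by rewrite ltr_pwDr.
have [J uJ] := su (eps / (`|c| + 1)) (divr_gt0 eps0 c1).
exists J => j jJ; rewrite normrM -[leRHS](divfK (lt0r_neq0 c1)) mulrC.
by rewrite ler_pM ?uJ // lerDl.
Qed.

Lemma small_eq u v : u =1 v -> small v -> small u.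
Proof. by move=> /funext ->. Qed.

Lemma small_sum I (r : seq I) (F : I -> nat -> R) :
  (forall i, small (F i)) -> small (fun j => \sum_(i <- r) F i j).
Proof.
move=> sF; elim: r => [|i r IH].
  by apply: small_eq small0 => j; rewrite big_nil.
by apply: small_eq (smallD (sF i) IH) => j; rewrite big_cons.
Qed.

Lemma small_const c : small (fun=> c) -> c = 0.
Proof.
move=> sc; apply/eqP; rewrite -normr_eq0 eq_le normr_ge0 andbT.
by apply/ler_addgt0Pl => e e0; have [J /(_ J (leqnn J))] := sc e e0; rewrite addr0.
Qed.

Lemma small_inv_nat c : small (fun j => c / j.+1%:R).
Proof.
apply: smallZ => eps eps0; exists (Num.truncn eps^-1) => j jJ.
rewrite ger0_norm ?invr_ge0 // invf_ple ?posrE //.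
apply: ltW; apply: lt_le_trans (_ : (Num.truncn eps^-1).+1%:R <= _).
  by rewrite truncnS_gt.
by rewrite ler_nat.
Qed.

End Small.

Arguments small_le {R u v} _ _.
Arguments small_eq {R u v} _ _.
Arguments small0 {R}.
Arguments smallD {R u v} _ _.
Arguments smallZ {R} c {u} _.
Arguments small_sum {R I} r {F} _.
Arguments small_inv_nat {R} c.

Section Rates.
Variable R : realType.

(** The truncation at K = 4 ^ j goes with t = 1 - 2 ^ (- j): then K grows fast
    enough for K ^ 4 t ^ K to tend to 0, but log K slowly enough for
    (1 - t) (log K) ^ 4 to do so. *)
Definition tseq (j : nat) : R := 1 - 2 ^- j.
Definition harmonic_sum (K : nat) : R := \sum_(i < K) i.+1%:R^-1.

Lemma tseq_ge0 j : 0 <= tseq j.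
Proof. by rewrite subr_ge0 invf_le1 ?exprn_gt0 // exprn_ege1 // ler1n. Qed.

Lemma tseq_le1 j : tseq j <= 1.
Proof. by rewrite gerBl invr_ge0 exprn_ge0. Qed.

Lemma bernoulli_sub (x : R) n : 0 <= x <= 1 -> 1 - x ^+ n <= n%:R * (1 - x).
Proof.
move=> /andP[x0 x1]; elim: n => [|n IH]; first by rewrite expr0 subrr mul0r.
rewrite exprS -natr1.
have : x ^+ n <= 1 by rewrite exprn_ile1.
have : 0 <= x ^+ n by rewrite exprn_ge0.
by move: IH; set y := x ^+ n; nra.
Qed.

Lemma bernoulli_inv (x : R) n : 0 <= x <= 1 -> (1 - x) ^+ n * (1 + n%:R * x) <= 1.
Proof.
move=> /andP[x0 x1]; elim: n => [|n IH]; first by rewrite expr0 mul0r addr0 mulr1.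
apply: le_trans IH; rewrite exprSr -mulrA ler_wpM2l ?exprn_ge0 ?subr_ge0 //.
by rewrite -natr1; have : 0 <= n%:R :> R by []; set y := n%:R : R; nra.
Qed.

(** Each dyadic block of the harmonic sum is at most 1. *)
Lemma harmonic_sum_pow2 i : harmonic_sum (2 ^ i) <= i.+1%:R.
Proof.
elim: i => [|i IH]; first by rewrite /harmonic_sum big_ord1 invr1.
rewrite /harmonic_sum expnS mul2n -addnn big_split_ord /= -natr1 lerD //.
apply: le_trans (_ : \sum_(j < 2 ^ i) (2 ^ i)%:R^-1 <= _); last first.
  by rewrite sumr_const card_ord -(mulr_natr (2 ^ i)%:R^-1) mulVf // pnatr_eq0 expn_eq0.
apply: ler_sum => j _; rewrite lef_pV2 ?posrE ?ltr0n ?expn_gt0 // ler_nat; lia.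
Qed.

Lemma small_quartic_pow2 : small (fun j => 2 ^- j * (1 + 2 * j%:R) ^+ 4 : R).
Proof.
(* From the index 7 on, (1 + 2 j) ^ 5 is multiplied at each step by at most
   (17 / 15) ^ 5 < 2. *)
have h j : (1 + 2 * (j + 7)%:R) ^+ 5 <= 2 ^+ 15 * 2 ^+ (j + 7) :> R.
  elim: j => [|j IH]; first lra.
  rewrite addSn [2 ^+ (j + 7).+1]exprS mulrCA.
  apply: le_trans (ler_wpM2l (ler0n _ 2) IH).
  have y15 : 15 <= 1 + 2 * (j + 7)%:R :> R.
    by rewrite natrD; have : 0 <= j%:R :> R by []; lra.
  rewrite -(natr1 (j + 7)); set y := 1 + 2 * (j + 7)%:R in y15 *.
  have -> : 1 + 2 * ((j + 7)%:R + 1) = y + 2 by rewrite /y; ring.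
  apply: le_trans (_ : (17 / 15 * y) ^+ 5 <= _).
    by rewrite lerXn2r // ?nnegrE; lra.
  rewrite exprMn ler_wpM2r ?exprn_ge0 //; lra.
apply: small_le _ (small_inv_nat (2 ^+ 15)); exists 7%N => j j7.
have := h (j - 7)%N; rewrite subnK // => hj.
have y0 : 0 <= 1 + 2 * j%:R :> R by rewrite addr_ge0 ?mulr_ge0.
rewrite ger0_norm ?mulr_ge0 ?invr_ge0 ?exprn_ge0 // ler_pdivlMr ?ltr0Sn //.
rewrite -mulrA mulrC ler_pdivrMr ?exprn_gt0 //; apply: le_trans hj.
rewrite [leRHS]exprSr ler_wpM2l ?exprn_ge0 // -natr1.
by have : 0 <= j%:R :> R by []; lra.
Qed.

Lemma small_harmonic :
  small (fun j => (1 - tseq j) * harmonic_sum (4 ^ j) ^+ 4).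
Proof.
apply: small_le _ small_quartic_pow2; exists 0%N => j _.
have H0 : 0 <= harmonic_sum (4 ^ j) by apply: sumr_ge0 => i _; rewrite invr_ge0.
have HH : harmonic_sum (4 ^ j) <= 1 + 2 * j%:R.
  rewrite (_ : 4 ^ j = 2 ^ (2 * j))%N; last by rewrite expnM.
  by apply: le_trans (harmonic_sum_pow2 _) _; rewrite -natr1 natrM addrC.
rewrite /tseq opprB addrC subrK ger0_norm ?mulr_ge0 ?invr_ge0 ?exprn_ge0 //.
by rewrite ler_wpM2l ?invr_ge0 ?exprn_ge0 // lerXn2r ?nnegrE // (le_trans H0).
Qed.

(** Since (1 - 1 / n) ^ n <= 1 / 2 for n = 2 ^ j, the power t ^ K is at most
    2 ^ (- 2 ^ j), whereas K ^ 4 = 2 ^ (8 j). *)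
Lemma small_tail : small (fun j => (4 ^ j)%:R ^+ 4 * tseq j ^+ (4 ^ j)).
Proof.
have tn j : tseq j ^+ (2 ^ j) <= 2^-1.
  have x01 : 0 <= (2 ^- j : R) <= 1.
    by rewrite invr_ge0 exprn_ge0 //= invf_le1 ?exprn_gt0 // exprn_ege1 // ler1n.
  have := bernoulli_inv (2 ^ j) x01; rewrite natrX divff ?expf_neq0 //.
  by rewrite -/(tseq j); lra.
have ineq j : (6 <= j -> 8 * j + j <= 2 ^ j)%N.
  move=> j6; rewrite -(subnK j6); elim: (j - 6)%N => // i IH.
  by rewrite addSn expnS; lia.
apply: small_le _ small_quartic_pow2; exists 6%N => j j6.
rewrite ger0_norm ?mulr_ge0 ?exprn_ge0 ?tseq_ge0 //.
rewrite (_ : 4 ^ j = 2 ^ j * 2 ^ j)%N; last by rewrite -expnMn.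
rewrite [tseq j ^+ _]exprM.
have t2 : (tseq j ^+ (2 ^ j)) ^+ (2 ^ j) <= 2 ^- (8 * j + j).
  apply: le_trans (_ : (2^-1) ^+ (2 ^ j) <= _).
    by rewrite lerXn2r ?nnegrE ?exprn_ge0 ?tseq_ge0.
  by rewrite exprVn lef_pV2 ?posrE ?exprn_gt0 // ler_eXn2l ?ltr1n // ineq.
apply: le_trans (_ : (2 ^ j * 2 ^ j)%:R ^+ 4 * 2 ^- (8 * j + j) <= _).
  by rewrite ler_wpM2l ?exprn_ge0.
have -> : (2 ^ j * 2 ^ j)%:R ^+ 4 = 2 ^+ (8 * j) :> R.
  by rewrite natrM natrX -exprD -exprM; congr (_ ^+ _); lia.
rewrite exprD invfM mulrA divff ?expf_neq0 // mul1r.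
rewrite ler_peMr ?invr_ge0 ?exprn_ge0 // exprn_ege1 //.
by have : 0 <= j%:R :> R by []; lra.
Qed.
End Rates.

Arguments small_harmonic : clear implicits.
Arguments small_tail : clear implicits.

(** * Estimates on the box *)

Section BoxEstimates.
Variable R : realType.
Implicit Types (t : R) (m n p q K : nat) (k : 'X_{1..4}).

Lemma ler_norm_sum_box K (F G : nat -> nat -> nat -> nat -> R) :
  (forall m n p q, `|F m n p q| <= G m n p q) -> `|sum_box K F| <= sum_box K G.
Proof.
move=> FG; do 4![apply: le_trans (ler_norm_sum _ _ _) _; apply: ler_sum => ? _].
exact: FG.
Qed.

Lemma sum_box_const K (c : R) : sum_box K (fun _ _ _ _ => c) = K%:R ^+ 4 * c.
Proof.
rewrite /sum_box !sumr_const !card_ord -!mulrnA -[LHS]mulr_natl !natrM.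
by rewrite !exprS expr0 mulr1 !mulrA.
Qed.

Lemma sum_box_prod K (f : nat -> R) :
  sum_box K (fun m n p q => f m * f n * f p * f q) = (\sum_(i < K) f i) ^+ 4.
Proof.
transitivity ((\sum_(m < K) \sum_(n < K) f m * f n) ^+ 2).
  rewrite expr2 mulr_suml; apply: eq_bigr => m _; rewrite mulr_suml.
  apply: eq_bigr => n _; rewrite mulr_sumr; apply: eq_bigr => p _.
  by rewrite mulr_sumr; apply: eq_bigr => q _; rewrite mulrA.
rewrite (_ : \sum_(m < K) _ = (\sum_(i < K) f i) ^+ 2) -?exprM //.
by rewrite expr2 mulr_suml; apply: eq_bigr => m _; rewrite mulr_sumr.
Qed.

Let inv_ge0 n : 0 <= (n.+1%:R^-1 : R). Proof. by rewrite invr_ge0. Qed.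
Let inv_le1 n : (n.+1%:R^-1 : R) <= 1.
Proof. by rewrite invf_le1 ?ltr0Sn // ler1n. Qed.
#[local] Hint Resolve inv_ge0 inv_le1 : core.

Lemma weight_ge0 m n p q k : 0 <= weight R m n p q k.
Proof. by rewrite /weight !mulr_ge0 // -exprVn exprn_ge0. Qed.

Lemma weight_le1 m n p q k : weight R m n p q k <= 1.
Proof.
by rewrite /weight -!exprVn !mulr_ile1 ?mulr_ge0 ?exprn_ge0 ?exprn_ile1.
Qed.

Definition inv_box m n p q : R := m.+1%:R^-1 * n.+1%:R^-1 * p.+1%:R^-1 * q.+1%:R^-1.

(** An index whose exponent is at least 2 can be spared once. *)
Lemma weight_le m n p q k i : (0 < k i)%N ->
  weight R m n p q k * (nth 0%N [:: m; n; p; q] i).+1%:R <= inv_box m n p q.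
Proof.
move=> ki; have P (a : nat) j : (a.+1%:R : R) ^- j.+1 <= a.+1%:R^-1.
  by rewrite -exprVn exprS ler_piMr ?exprn_ile1.
have Q (a : nat) j : (0 < j)%N -> (a.+1%:R : R) ^- j.+1 * a.+1%:R <= a.+1%:R^-1.
  case: j => // j _; rewrite exprSr invfM -mulrA mulVf ?mulr1; last by rewrite pnatr_eq0.
  exact: P.
have N (a : nat) j : 0 <= (a.+1%:R : R) ^- j.+1 by rewrite invr_ge0 exprn_ge0.
pose l (i : 'I_4) := nth 0%N [:: m; n; p; q] i.
have -> : weight R m n p q k = \prod_i (l i).+1%:R ^- (k i).+1 by rewrite prod4.
have -> : inv_box m n p q = \prod_i (l i).+1%:R^-1 by rewrite prod4.
rewrite (bigD1 i) // [leRHS](bigD1 i) //= mulrAC ler_pM ?mulr_ge0 ?prodr_ge0 ?Q //.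
by apply: ler_prod => j _; rewrite N P.
Qed.

(** The edge i > j of the cycle contributes this factor to the value at t of
    [cyc_poly]. *)
Definition cyc_factor t j i : R := t ^+ j.+1 - (j < i)%N%:R.

Definition eval_cyc t m n p q : R := cyc_factor t n m * cyc_factor t p n * cyc_factor t q p * cyc_factor t m q.

Lemma cyc_factor_le1 t j i : 0 <= t <= 1 -> `|cyc_factor t j i| <= 1.
Proof.
move=> /andP[t0 t1]; have := exprn_ge0 j.+1 t0; have := exprn_ile1 j.+1 t0 t1.
rewrite /cyc_factor; case: ltnP => _; rewrite ?mulr1n ?mulr0n => x1 x0; rewrite ler_norml; lra.
Qed.

Lemma cyc_factor_lt t j i : 0 <= t <= 1 -> (j < i)%N -> `|cyc_factor t j i| <= j.+1%:R * (1 - t).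
Proof.
move=> t01 ji; rewrite /cyc_factor ji distrC ger0_norm ?bernoulli_sub //.
by case/andP: t01 => t0 t1; rewrite subr_ge0 exprn_ile1.
Qed.

(** Off the diagonal the cycle contains a descent to its least entry, and the
    factor of this descent is at most (1 - t) times that entry, hence at most
    (1 - t) times any entry. On the diagonal the value is the fourth power of
    t ^ m.+1, which is close to 1. *)
Lemma eval_cyc_bound t m n p q i : 0 <= t <= 1 -> (i < 4)%N ->
  `|eval_cyc t m n p q - [&& m == n, n == p & p == q]%:R|
    <= 4 * (1 - t) * (nth 0%N [:: m; n; p; q] i).+1%:R.
Proof.
move=> t01 i4; set x := nth _ _ _.
have [t0 t1] := andP t01.
have xP : [|| x == m, x == n, x == p | x == q].
  by rewrite /x; case: i i4 {x} => [|[|[|[|//]]]] _ /=; rewrite eqxx ?orbT.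
have x0 : 0 <= (1 - t) * x.+1%:R by rewrite mulr_ge0 ?subr_ge0.
have [/and3P[/eqP mn /eqP np /eqP pq]|ne] := boolP [&& _, _ & _].
  have -> : x = m by case/or4P: xP => /eqP ->; rewrite ?mn ?np ?pq.
  rewrite /eval_cyc -pq -np -mn /cyc_factor ltnn subr0 mulr1n.
  rewrite -!exprD distrC ger0_norm ?subr_ge0 ?exprn_ile1 //.
  apply: le_trans (bernoulli_sub _ t01) _.
  by rewrite (_ : (_ + _ + _ + _)%N = (4 * m.+1)%N) ?natrM; [lra|lia].
rewrite subr0.
have D j i' : (j < i')%N -> (j <= x)%N -> `|cyc_factor t j i'| <= (1 - t) * x.+1%:R.
  move=> ji jx; apply: le_trans (cyc_factor_lt t01 ji) _; rewrite mulrC.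
  by rewrite ler_wpM2l ?subr_ge0 // ler_nat ltnS.
suff : `|eval_cyc t m n p q| <= (1 - t) * x.+1%:R by rewrite -mulrA; lra.
have L (a b c d e : R) : `|a| <= e -> `|b| <= 1 -> `|c| <= 1 -> `|d| <= 1 ->
    `|a * b * c * d| <= e.
  move=> ae b1 c1 d1; rewrite !normrM -!mulrA; apply: le_trans ae.
  by rewrite ler_piMr // !mulr_ile1 ?mulr_ge0.
have : [|| [&& n < m & n <= x], [&& p < n & p <= x], [&& q < p & q <= x]
         | [&& m < q & m <= x]]%N by lia.
rewrite /eval_cyc; case/or4P => /andP[ji jx].
- by apply: L; rewrite ?cyc_factor_le1 ?D.
- by rewrite [cyc_factor t n m * _]mulrC; apply: L; rewrite ?cyc_factor_le1 ?D.
- by rewrite [_ * cyc_factor t q p]mulrC !mulrA; apply: L; rewrite ?cyc_factor_le1 ?D.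
- by rewrite mulrC !mulrA; apply: L; rewrite ?cyc_factor_le1 ?D.
Qed.

End BoxEstimates.

(** * Comparison of the two sides *)

Section Comparison.
Variable R : realType.
Variables (t : R) (K : nat).
Hypothesis t01 : 0 <= t <= 1.
Implicit Types (w : {poly int}) (m n p q : nat) (k : 'X_{1..4}).

Definition trunc_eval w : R := \sum_(N < K.+1) t ^+ N * (w`_N)%:~R.

Let teval w : R := (map_poly intr w).[t].

(* The factor 'X^a makes the error bound stable under multiplication by
   'X^b - h. *)
Let terr w a : R := trunc_eval ('X^a * w) - t ^+ a * teval w.

Let terr1 a : `|terr 1 a| <= t ^+ K.
Proof.
have [t0 t1] := andP t01; rewrite /terr /teval rmorph1 hornerC !mulr1 /trunc_eval.
have [aK|Ka] := leqP a K.
  rewrite (bigD1 (Ordinal (aK : a < K.+1)%N)) //= coefXn eqxx mulr1 big1.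
    by rewrite addr0 subrr normr0 exprn_ge0.
  move=> i ia; rewrite coefXn (_ : (_ == _) = false) ?mulr0 //.
  by apply: contraNF ia => /eqP iE; apply/eqP/val_inj.
rewrite big1 => [|i _]; last first.
  rewrite coefXn (_ : (_ == _) = false) ?mulr0 //.
  by apply/eqP => iE; have := ltn_ord i; lia.
by rewrite sub0r normrN ger0_norm ?exprn_ge0 // ler_wiXn2l // ltnW.
Qed.

Let terr_step w c b (h : bool) : (forall a, `|terr w a| <= c) ->
  forall a, `|terr (w * ('X^b - h%:R)) a| <= c + c.
Proof.
move=> wc a; have -> : terr (w * ('X^b - h%:R)) a = terr w (a + b) - h%:R * terr w a.
  have tE : teval (w * ('X^b - h%:R)) = teval w * (t ^+ b - h%:R).
    by rewrite /teval rmorphM rmorphB /= map_polyXn rmorph_nat !hornerE hornerMn hornerC.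
  have sE : trunc_eval ('X^a * (w * ('X^b - h%:R))) =
      trunc_eval ('X^(a + b) * w) - h%:R * trunc_eval ('X^a * w).
    rewrite /trunc_eval mulr_sumr -sumrB; apply: eq_bigr => N _.
    have -> : 'X^a * (w * ('X^b - h%:R)) = 'X^(a + b) * w - ('X^a * w) *+ h.
      by rewrite exprD -mulr_natr; ring.
    by rewrite coefB coefMn rmorphB rmorphMn /= -mulr_natr; ring.
  rewrite /terr tE sE (exprD t); ring.
apply: le_trans (ler_normB _ _) _; apply: lerD; first exact: wc.
by case: h; rewrite ?mul1r ?mul0r ?normr0 ?wc // (le_trans _ (wc a)).
Qed.

(** Each of the four factors doubles the number of monomials, and truncation
    changes the value of a monomial by at most t ^ K. *)
Lemma trunc_eval_cyc (m n p q : nat) :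
  `|trunc_eval (cyc_poly m n p q) - eval_cyc t m n p q| <= 16 * t ^+ K.
Proof.
have := terr_step m.+1 (m < q)%N (terr_step q.+1 (q < p)%N (terr_step p.+1 (p < n)%N
  (terr_step n.+1 (n < m)%N terr1))) 0%N.
rewrite mul1r /terr expr0 !mul1r -/(cyc_poly m n p q).
have -> : teval (cyc_poly m n p q) = eval_cyc t m n p q.
  rewrite /teval /cyc_poly !rmorphM !rmorphB /= !map_polyXn !rmorph_nat !hornerE.
  by rewrite !hornerMn !hornerC.
by move=> /le_trans -> //; rewrite le_eqVlt; apply/orP; left; apply/eqP; ring.
Qed.

(* The diagonal of the box. *)
Lemma sum_box_diag k :
  sum_box K (fun m n p q =>
    [&& m == n, n == p & p == q]%:R * weight R m n p q k)
  = \sum_(i < K) i.+1%:R ^- (mdeg k + 4).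
Proof.
have D (V : nmodType) (i : 'I_K) (F : 'I_K -> V) :
    \sum_(j < K) (if (i == j :> nat) then F j else 0) = F i.
  by rewrite -big_mkcond (big_pred1 i).
apply: eq_bigr => m _; rewrite -[RHS](D _ m (fun=> _)); apply: eq_bigr => n _.
case: eqP => [mn|_]; last by rewrite big1 // => p _; rewrite big1 // => q _; rewrite mul0r.
rewrite -[RHS](D _ n (fun=> _)); apply: eq_bigr => p _ /=.
case: eqP => [np|_]; last by rewrite big1 // => q _; rewrite mul0r.
rewrite -[RHS](D _ p (fun=> _)); apply: eq_bigr => q _ /=.
case: eqP => [pq|_]; last by rewrite mul0r.
rewrite mul1r /weight -pq -np -mn -!invfM -!exprD; congr (_ ^- _).
rewrite mdegE -big_enum enum4 !big_cons big_nil /=; lia.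
Qed.

Lemma sum_boxMl (c : R) F :
  c * sum_box K F = sum_box K (fun m n p q => c * F m n p q).
Proof.
rewrite /sum_box mulr_sumr; apply: eq_bigr => m _; rewrite mulr_sumr.
apply: eq_bigr => n _; rewrite mulr_sumr; apply: eq_bigr => p _.
by rewrite mulr_sumr.
Qed.

Lemma sum_inv_box :
  sum_box K (fun m n p q => inv_box R m n p q) = harmonic_sum R K ^+ 4.
Proof. exact: (sum_box_prod K (fun i => i.+1%:R^-1)). Qed.

(** Some exponent is at least 2 because the monomial is not constant; this is
    the index i at which [weight_le] is used. *)
Lemma diagonal_approx k : (0 < mdeg k)%N ->
  `|\sum_(N < K.+1) t ^+ N * fps_zact (Qcoef R K N) Omega k
    - \sum_(i < K) i.+1%:R ^- (mdeg k + 4)|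
  <= 16 * (K%:R ^+ 4 * t ^+ K) + 4 * ((1 - t) * harmonic_sum R K ^+ 4).
Proof.
move=> k0; have [t0 t1] := andP t01.
have [i ki] : exists i : 'I_4, (0 < k i)%N.
  apply/existsP; apply: contraLR k0; rewrite negb_exists => /forallP h.
  rewrite -eqn0Ngt mdegE sum_nat_eq0; apply/forallP => i; apply/implyP => _.
  by have := h i; rewrite lt0n negbK.
have -> : \sum_(N < K.+1) t ^+ N * fps_zact (Qcoef R K N) Omega k =
    sum_box K (fun m n p q => trunc_eval (cyc_poly m n p q) * weight R m n p q k).
  transitivity (\sum_(N < K.+1) sum_box K (fun m n p q =>
      t ^+ N * ((cyc_poly m n p q)`_N)%:~R * weight R m n p q k)).
    apply: eq_bigr => N _; rewrite fps_zact_Qcoef; last by rewrite -ltnS.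
    rewrite sum_boxMl; apply: eq_sum_box => m n p q _ _ _ _; exact: mulrA.
  by rewrite -sum_box_sum; apply: eq_sum_box => m n p q _ _ _ _; rewrite mulr_suml.
rewrite -sum_box_diag sum_boxN sum_boxD.
apply: (@le_trans _ _ (sum_box K (fun m n p q =>
   16 * t ^+ K + 4 * (1 - t) * inv_box R m n p q))).
  apply: ler_norm_sum_box => m n p q; rewrite -mulrBl normrM (ger0_norm (weight_ge0 _ _ _ _ _ _)).
  have E1 := trunc_eval_cyc m n p q.
  have E2 := eval_cyc_bound m n p q t01 (ltn_ord i).
  have w0 := weight_ge0 R m n p q k; have w1 := weight_le1 R m n p q k.
  apply: le_trans (ler_wpM2r w0 (ler_distD (eval_cyc t m n p q) _ _)) _.
  rewrite mulrDl; apply: lerD.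
    apply: le_trans E1; exact: ler_piMr.
  apply: le_trans (ler_wpM2r w0 E2) _; rewrite -!mulrA ler_wpM2l // ler_wpM2l ?subr_ge0 //.
  by rewrite mulrC; apply: weight_le.
rewrite -sum_boxD sum_box_const -sum_boxMl sum_inv_box le_eqVlt.
apply/orP; left; apply/eqP; ring.
Qed.

Lemma Qcoef_approx k : (0 < k i0)%N ->
  `|sum_box K (fun m n p q =>
      ((n < m)%N * (p < n)%N * (q < p)%N)%:R * weight R m n p q k)
    - \sum_(N < K.+1) t ^+ N * Qcoef R K N k|
  <= (1 - t) * harmonic_sum R K ^+ 4.
Proof.
move=> k0; have [t0 t1] := andP t01.
have -> : \sum_(N < K.+1) t ^+ N * Qcoef R K N k = sum_box K (fun m n p q =>
    (((n < m)%N * (p < n)%N * (q < p)%N)%:R * weight R m n p q k) * t ^+ m.+1).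
  transitivity (\sum_(N < K.+1) sum_box K (fun m n p q => t ^+ N *
      (((n < m)%N * (p < n)%N * (q < p)%N * (N == m.+1 :> nat))%:R * weight R m n p q k))).
    by apply: eq_bigr => N _; rewrite /Qcoef k0 sum_boxMl.
  rewrite -sum_box_sum; apply: eq_sum_box => m n p q mK _ _ _.
  rewrite (bigD1 (Ordinal (mK : m.+1 < K.+1)%N)) //= eqxx muln1 big1.
    by rewrite addr0 mulrC.
  move=> N Nm; rewrite (_ : (N == m.+1 :> nat) = false) ?muln0 ?mul0r ?mulr0 //.
  by apply: contraNF Nm => /eqP iE; apply/eqP/val_inj.
rewrite sum_boxN sum_boxD -sum_inv_box sum_boxMl; apply: ler_norm_sum_box => m n p q.
rewrite -{1}[_ * weight _ _ _ _ _ _]mulr1 -mulrBr normrM.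
have w0 := weight_ge0 R m n p q k.
rewrite [X in _ * X]ger0_norm ?subr_ge0 ?exprn_ile1 //.
apply: le_trans (_ : weight R m n p q k * (m.+1%:R * (1 - t)) <= _).
  apply: ler_pM; rewrite ?bernoulli_sub ?subr_ge0 ?exprn_ile1 //.
  rewrite normrM normr_nat (ger0_norm w0) ler_piMl // (_ : 1 = 1%:R) // ler_nat.
  by case: (n < m)%N; case: (p < n)%N; case: (q < p)%N.
rewrite mulrA mulrC ler_wpM2l ?subr_ge0 //; exact: weight_le k0.
Qed.
End Comparison.

(** * Multiple zeta values as limits *)

(** An unordered sum of nonnegative terms is the limit along any exhaustion by
    finite sets, provided that the partial sums are bounded. *)
Section Exhaustion.
Variables (R : realType) (T : choiceType) (S : set T) (a : T -> R).
Variables (C : nat -> seq T) (M : R).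
Hypothesis a0 : forall x, 0 <= a x.
Hypothesis uC : forall K, uniq (C K).
Hypothesis CS : forall K x, x \in C K -> S x.
Hypothesis SC : forall x, S x -> exists J, forall K, (J <= K)%N -> x \in C K.
Hypothesis CM : forall K, \sum_(x <- C K) a x <= M.

Let sumC K : (\sum_(x \in [set` C K]) (a x)%:E = (\sum_(x <- C K) a x)%:E)%E.
Proof. by rewrite -fsbig_seq // sumEFin. Qed.

Let leC K : ((\sum_(x <- C K) a x)%:E <= \esum_(x in S) (a x)%:E)%E.
Proof.
rewrite -sumC; apply: ereal_sup_ubound; exists [set` C K]%classic => //.
by split; [exact: finite_seq|move=> x /CS].
Qed.

Let coverC (X : set T) : fsets S X ->
  exists J, forall K, (J <= K)%N ->
    (\sum_(x \in X) (a x)%:E <= (\sum_(x <- C K) a x)%:E)%E.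
Proof.
move=> [/finite_seqP [s ->] sS].
have [J JP] : exists J, forall K, (J <= K)%N -> {subset s <= C K}.
  elim: s sS => [|x s IH] sS; first by exists 0%N.
  have [|J JP] := IH; first by move=> y ys; apply: sS; rewrite /= inE ys orbT.
  have [|J' J'P] := @SC x; first by apply: sS; rewrite /= inE eqxx.
  exists (maxn J J') => K; rewrite geq_max => /andP[JK J'K] y.
  by rewrite inE => /predU1P[->|]; [exact: J'P|exact: JP].
exists J => K JK; rewrite -sumC; apply: lee_fsum_nneg_subset.
- exact: finite_seq.
- exact: finite_seq.
- by move=> x; rewrite !inE; apply: JP.
- by move=> x _; rewrite lee_fin.
Qed.

Lemma esum_exhaustion :
  small (fun K => fine (\esum_(x in S) (a x)%:E) - \sum_(x <- C K) a x).
Proof.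
have EM : (\esum_(x in S) (a x)%:E <= M%:E)%E.
  apply: ge_ereal_sup => _ [X XS <-]; have [J /(_ J (leqnn J))] := coverC XS.
  by move=> /le_trans -> //; rewrite lee_fin.
have E0 : (0 <= \esum_(x in S) (a x)%:E)%E by apply: esum_ge0 => x _; rewrite lee_fin.
have Efin : (\esum_(x in S) (a x)%:E)%E \is a fin_num.
  by rewrite ge0_fin_numE // (le_lt_trans EM) // ltry.
move=> eps eps0; have [_ [X XS <-]] := ub_ereal_sup_adherent eps0 Efin.
rewrite -/(esum _ _) => lt; have [J JP] := coverC XS; exists J => K JK.
have := leC K; have := lt_le_trans lt (JP K JK); rewrite -(fineK Efin) -EFinB.
rewrite !lte_fin !lee_fin => h1 h2.
by rewrite ger0_norm ?subr_ge0 // lerBlDr -lerBlDl ltW.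
Qed.
End Exhaustion.
Arguments esum_exhaustion {R T S a C M} _ _ _ _ _.

Section MzvLimits.
Variable R : realType.
Implicit Types (k : 'X_{1..4}) (K : nat).

Lemma small_sub (u : nat -> R) (f : nat -> nat) :
  (forall j, (j <= f j)%N) -> small u -> small (u \o f).
Proof.
move=> jf su eps /su[J JP]; exists J => j jJ; apply: JP; exact: leq_trans jJ (jf j).
Qed.

(** Telescoping, with 1 / (m + 1) ^ 2 <= 1 / m - 1 / (m + 1). *)
Lemma sum_inv_sq K n :
  \sum_(m < K) (n < m)%N%:R * m.+1%:R ^- 2 <= n.+1%:R^-1 :> R.
Proof.
have [Kn|nK] := leqP K n.
  rewrite big1 ?invr_ge0 // => m _; rewrite ltnNge (_ : (m <= n)%N) ?mul0r //.
  by have := ltn_ord m; lia.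
suff : \sum_(m < K) (n < m)%N%:R * m.+1%:R ^- 2 <= n.+1%:R^-1 - K%:R^-1 :> R.
  by move=> /le_trans -> //; rewrite gerBl invr_ge0.
rewrite -(subnKC nK); elim: (K - n.+1)%N => [|i IH].
  rewrite addn0 subrr big1 // => m _.
  by rewrite ltnNge (_ : (m <= n)%N) ?mul0r // -ltnS.
rewrite addnS big_ord_recr /= (_ : (n < n.+1 + i)%N); last by lia.
rewrite mul1r; apply: le_trans (lerD IH (lexx _)) _; set x : R := (n.+1 + i)%:R.
have x0 : 0 < x by rewrite ltr0n.
have xn : x != 0 by rewrite lt0r_neq0.
have x1 : x + 1 != 0 by rewrite lt0r_neq0 // addr_gt0.
have -> : (n.+1 + i).+1%:R = x + 1 :> R by rewrite natr1.
clearbody x; rewrite -addrA lerD2l -subr_ge0.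
have -> : - (x + 1)^-1 - (- x^-1 + (x + 1) ^- 2) = x^-1 * (x + 1) ^- 2.
  by field; rewrite ?xn ?x1.
by rewrite mulr_ge0 ?invr_ge0 ?exprn_ge0 ?addr_ge0 ?ltW.
Qed.

Lemma sum_inv_sq_le2 K : \sum_(m < K) m.+1%:R ^- 2 <= 2 :> R.
Proof.
case: K => [|K]; first by rewrite big_ord0.
have := sum_inv_sq K.+1 0; rewrite invr1 !big_ord_recl /= mul0r add0r => h.
rewrite expr1n invr1 (_ : 2 = 1 + 1) // lerD2l; apply: le_trans h.
by apply: ler_sum => i _; rewrite mul1r.
Qed.

Lemma mzv1_limit (w : nat) : (2 <= w)%N ->
  small (fun K => mzv R [tuple w] - \sum_(i < K) i.+1%:R ^- w).
Proof.
move=> w2; pose a (m : 1.-tuple nat) : R := \prod_(i < 1) (tnth m i)%:R ^- tnth [tuple w] i.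
pose C K : seq (1.-tuple nat) := [seq [tuple i.+1] | i <- iota 0 K].
have CE K : \sum_(x <- C K) a x = \sum_(i < K) i.+1%:R ^- w.
  rewrite big_map -[K in iota 0 K]subn0 -/(index_iota 0 K) big_mkord; apply: eq_bigr => i _.
  by rewrite /a big_ord1 !tnth0.
rewrite /mzv; apply: small_eq _ (esum_exhaustion (a := a) (C := C) (M := 2) _ _ _ _ _).
- by move=> K; rewrite CE.
- by move=> x; apply: prodr_ge0 => i _; rewrite invr_ge0 exprn_ge0.
- by move=> K; rewrite map_inj_uniq ?iota_uniq // => i j [].
- by move=> K x /mapP[i _ ->].
- move=> x /=; case/tupleP: x => n x; rewrite [x]tuple0 /= andbT => n0.
  exists n => K nK; apply/mapP; exists n.-1; last by apply: val_inj; rewrite /= prednK.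
  by rewrite mem_iota; lia.
move=> K; rewrite CE; apply: le_trans (sum_inv_sq_le2 K); apply: ler_sum => i _.
by rewrite lef_pV2 ?posrE ?exprn_gt0 ?ltr0Sn // ler_weXn2l // ler1n.
Qed.

Definition chain_box K k : R := sum_box K (fun m n p q =>
  ((n < m)%N * (p < n)%N * (q < p)%N)%:R * weight R m n p q k).

(** By [sum_inv_sq] the sum of 1 / m ^ 2 over m > n is at most 1 / n, which
    turns the factor 1 / n of the next index into 1 / n ^ 2. So the largest
    indices can be summed out one after the other. *)
Lemma chain_box_le2 K k : (0 < k i0)%N -> chain_box K k <= 2.
Proof.
move=> k0; pose g n : R := n.+1%:R^-1; pose f n : R := n.+1%:R ^- 2.
pose lt (j i : nat) : R := (j < i)%N%:R.
have g0 n : 0 <= g n by rewrite invr_ge0.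
have l0 i j : 0 <= lt i j by [].
have fE n : f n = g n * g n by rewrite /f /g expr2 invfM.
have step n c : 0 <= c -> \sum_(m < K) lt n m * f m * c <= g n * c.
  by move=> c0; rewrite -mulr_suml ler_wpM2r // sum_inv_sq.
pose F m n p q := lt n m * f m * (lt p n * lt q p * (g n * g p * g q)).
apply: (@le_trans _ _ (sum_box K F)).
  apply: ler_sum => m _; apply: ler_sum => n _; apply: ler_sum => p _.
  apply: ler_sum => q _; rewrite /F.
  rewrite !natrM -/(lt n m) -/(lt p n) -/(lt q p).
  have -> : lt n m * f m * (lt p n * lt q p * (g n * g p * g q))
      = lt n m * lt p n * lt q p * (g m * inv_box R m n p q).
    by rewrite fE /inv_box -!/(g _); ring.
  rewrite ler_wpM2l ?mulr_ge0 // /g mulrC ler_pdivlMr ?ltr0Sn //.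
  exact: (@weight_le R m n p q k i0).
have -> : sum_box K F = \sum_(n < K) \sum_(p < K) \sum_(q < K) \sum_(m < K) F m n p q.
  exact: (sum_box_rot K (fun n p q m => F m n p q)).
apply: (@le_trans _ _ (\sum_(n < K) \sum_(p < K) \sum_(q < K)
    lt p n * f n * (lt q p * (g p * g q)))).
  apply: ler_sum => n _; apply: ler_sum => p _; apply: ler_sum => q _.
  apply: le_trans (step _ _ _) _; first by rewrite !mulr_ge0.
  by rewrite fE le_eqVlt; apply/orP; left; apply/eqP; ring.
rewrite exchange_big; under eq_bigr do rewrite exchange_big.
apply: (@le_trans _ _ (\sum_(p < K) \sum_(q < K) lt q p * f p * g q)).
  apply: ler_sum => p _; apply: ler_sum => q _.
  apply: le_trans (step _ _ _) _; first by rewrite !mulr_ge0.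
  by rewrite fE le_eqVlt; apply/orP; left; apply/eqP; ring.
rewrite exchange_big; apply: le_trans (sum_inv_sq_le2 K); apply: ler_sum => q _.
by apply: le_trans (step _ _ (g0 q)) _; rewrite -fE.
Qed.

Lemma sum_box_pairs K (F : nat -> nat -> nat -> nat -> R) :
  sum_box K F =
    \sum_(x : 'I_K * ('I_K * ('I_K * 'I_K))) F x.1 x.2.1 x.2.2.1 x.2.2.2.
Proof.
rewrite -(pair_bigA _ (fun (m : 'I_K) (y : 'I_K * ('I_K * 'I_K)) =>
  F m y.1 y.2.1 y.2.2)); apply: eq_bigr => m _.
rewrite -(pair_bigA _ (fun (n : 'I_K) (y : 'I_K * 'I_K) => F m n y.1 y.2)).
by apply: eq_bigr => n _; rewrite -(pair_bigA _ (fun p q : 'I_K => F m n p q)).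
Qed.

Lemma mzv4_limit k : (0 < k i0)%N ->
  small (fun K => mzv R [tuple (k i).+1 | i < 4] - chain_box K k).
Proof.
move=> k0; pose l := [tuple (k i).+1 | i < 4].
pose a (m : 4.-tuple nat) : R := \prod_(i < 4) (tnth m i)%:R ^- tnth l i.
pose P K := [pred x : 'I_K * ('I_K * ('I_K * 'I_K)) |
  [&& x.2.1 < x.1, x.2.2.1 < x.2.1 & x.2.2.2 < x.2.2.1]%N].
pose tau K (x : 'I_K * ('I_K * ('I_K * 'I_K))) : 4.-tuple nat :=
  [tuple x.1.+1; x.2.1.+1; x.2.2.1.+1; x.2.2.2.+1].
pose C K := [seq tau K x | x <- enum (P K)].
have CE K : \sum_(x <- C K) a x = chain_box K k.
  rewrite big_map big_enum_cond big_mkcond /chain_box sum_box_pairs.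
  apply: eq_bigr => -[m [n [p q]]] _; rewrite andbT !inE /= !mulnb -andbA.
  case: ifP => _; last by rewrite mul0r.
  rewrite mul1r /a /weight prod4 !tnth_mktuple.
  by rewrite !(tnth_nth 0%N).
rewrite /mzv; apply: small_eq _ (esum_exhaustion (a := a) (C := C) (M := 2) _ _ _ _ _).
- by move=> K; rewrite CE.
- by move=> x; apply: prodr_ge0 => i _; rewrite invr_ge0 exprn_ge0.
- move=> K; rewrite map_inj_uniq ?enum_uniq // => -[m [n [p q]]] [m' [n' [p' q']]].
  by case=> /val_inj -> /val_inj -> /val_inj -> /val_inj ->.
- move=> K x /mapP[[m [n [p q]]]]; rewrite mem_enum inE /= => h ->.
  by case/and3P: h => h1 h2 h3; rewrite /= !ltnS h1 h2 h3.
- move=> x /=; case/tupleP: x => m x; case/tupleP: x => n x.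
  case/tupleP: x => p x; case/tupleP: x => q x; rewrite [x]tuple0 /= !andbT => h.
  exists m => K mK; apply/mapP.
  have mK' : (m.-1 < K)%N by lia.
  have nK' : (n.-1 < K)%N by lia.
  have pK' : (p.-1 < K)%N by lia.
  have qK' : (q.-1 < K)%N by lia.
  exists (Ordinal mK', (Ordinal nK', (Ordinal pK', Ordinal qK'))).
    by rewrite mem_enum inE /=; lia.
  by apply: val_inj => /=; congr [:: _; _; _; _]; lia.
by move=> K; rewrite CE chain_box_le2.
Qed.

End MzvLimits.
Arguments small_sub {R u f} _ _.
Arguments mzv1_limit R {w} _.
Arguments mzv4_limit R {k} _.

(** * The theorem *)

Section Conclusion.
Variable R : realType.
Implicit Types (k : 'X_{1..4}).

(** The group ring acts on homogeneous parts by a finite matrix, so it commutes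
    with coefficientwise limits. *)
Definition act_coef (a : zgring (GL 4)) k (k' : 'X_{1..4}) : R :=
  \sum_(M <- dom a) (coeff M a)%:~R * (\prod_i mact M (mvars R) i ^+ k' i)@_k.

Lemma fps_zactE (f : fps 4 R) a k : fps_zact f a k =
  \sum_(k' : 'X_{1..4 < (mdeg k).+1} | mdeg k' == mdeg k) f k' * act_coef a k k'.
Proof.
rewrite /fps_zact; under [RHS]eq_bigr do rewrite mulr_sumr.
rewrite [RHS]exchange_big; apply: eq_bigr => M _.
rewrite fps_actE (raddf_sum (mcoeff k)) mulr_sumr; apply: eq_bigr => k' _.
rewrite [RHS]mulrCA; congr (_ * _); exact: mcoeffZ.
Qed.

Definition Qtrunc j k : R :=
  \sum_(N < (4 ^ j).+1) tseq R j ^+ N * Qcoef R (4 ^ j) N k.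

Lemma exp4_ge j : (j <= 4 ^ j)%N.
Proof. by apply: ltnW; apply: ltn_expl. Qed.

Lemma Qtrunc_limit k : small (fun j => Qseries R k - Qtrunc j k).
Proof.
rewrite /Qseries tnth_mktuple (_ : ord0 = i0); last exact: val_inj.
have [k0|k0] := posnP (k i0).
  rewrite k0; apply: small_eq _ small0 => j; rewrite /Qtrunc big1 ?subr0 // => N _.
  by rewrite /Qcoef k0 mulr0.
rewrite ltnS k0.
have chain_lim : small (fun j => chain_box R (4 ^ j) k - Qtrunc j k).
  apply: small_le _ (small_harmonic R); exists 0%N => j _.
  by apply: Qcoef_approx; rewrite ?tseq_ge0 ?tseq_le1.
apply: small_eq _ (smallD (small_sub exp4_ge (mzv4_limit R k0)) chain_lim) => j.
by rewrite /= addrA subrK.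
Qed.

(** Three limits are compared along j: the coefficients of Q with their
    truncations, the action of Omega on these with the diagonal sums, and the
    diagonal sums with the single zeta value. *)
Lemma Omega_diagonal k : (0 < mdeg k)%N ->
  fps_zact (Qseries R) Omega k = mzv R [tuple (mdeg k + 4)%N].
Proof.
move=> k0; apply/eqP; rewrite -subr_eq0; apply/eqP/(@small_const R).
pose diag j : R := \sum_(i < 4 ^ j) i.+1%:R ^- (mdeg k + 4).
have small1 : small (fun j => fps_zact (Qseries R) Omega k - fps_zact (Qtrunc j) Omega k).
  apply: small_eq _ (small_sum (index_enum _) (F := fun k' : 'X_{1..4 < (mdeg k).+1} =>
    fun j => if mdeg k' == mdeg k
             then act_coef Omega k k' * (Qseries R k' - Qtrunc j k') else 0) _) => [j|k'].
    rewrite !fps_zactE -sumrB big_mkcond; apply: eq_bigr => k' _; case: ifP => // _.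
    by rewrite mulrBr ![act_coef _ _ _ * _]mulrC.
  by case: eqP => _; [apply/smallZ/Qtrunc_limit|exact: small0].
have small2 : small (fun j => fps_zact (Qtrunc j) Omega k - diag j).
  apply: small_le _ (smallD (smallZ 16 (small_tail R)) (smallZ 4 (small_harmonic R))).
  exists 0%N => j _; apply: le_trans (diagonal_approx _ _ k0); last first.
    by rewrite tseq_ge0 tseq_le1.
  rewrite le_eqVlt; apply/orP; left; apply/eqP; congr (`|_ - _|).
  rewrite fps_zactE; under [RHS]eq_bigr do rewrite fps_zactE mulr_sumr.
  rewrite [RHS]exchange_big; apply: eq_bigr => k' _; rewrite /Qtrunc mulr_suml.
  by apply: eq_bigr => N _; rewrite mulrA.
have small3 : small (fun j => -1 * (mzv R [tuple (mdeg k + 4)%N] - diag j)).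
  apply: smallZ; apply: (small_sub exp4_ge (u := fun K => mzv R [tuple _] -
    \sum_(i < K) i.+1%:R ^- (mdeg k + 4))).
  by apply: mzv1_limit; lia.
apply: small_eq _ (smallD (smallD small1 small2) small3) => j /=; ring.
Qed.

End Conclusion.

Theorem theorem1p1 (R : realType) : fps_zact (Qseries R) Omega = qseries R.
Proof.
apply: funext => k; have wE : (\sum_(i < 4) (k i).+1 = mdeg k + 4)%N.
  rewrite mdegE -!big_enum enum4 !big_cons !big_nil /=; lia.
rewrite /qseries wE; have [k0|k0] := posnP (mdeg k); last first.
  by rewrite Omega_diagonal // -[X in (X < _)%N]add0n ltn_add2r k0.
rewrite k0 fps_zactE big1 // => k' /eqP k'0.
(* In degree 0 the only term is the one with all l_i = 1. *)
suff -> : Qseries R k' = 0 by rewrite mul0r.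
have /eqP : mdeg k' = 0%N by rewrite k'0.
rewrite mdeg_eq0 => /eqP ->.
by rewrite /Qseries tnth_mktuple mnm0E.
Qed.
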